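(* Let $\emptyset\neq\mathcal{A}\subseteq\mathbb{Q}^n$ and $\mathcal{B}\subseteq\mathbb{N}^n\setminus(2\mathbb{N})^n$ be finite and disjoint. A vector $\mathbf{v}\in\mathbb{R}^{\mathcal{A}\cup\mathcal{B}}$ is contained in the dual rational $\mathcal{S}$-cone $(C_{\mathcal{S}}(\mathcal{A},\mathcal{B}))^*$ if and only if there exists a circuit vector $\mathbf{y}^{\mathcal{A},\mathcal{B}}=(\mathbf{y}^{A,\beta})_{(A,\beta)\in R(\mathcal{A},\mathcal{A}\cup\mathcal{B})}$ satisfying, for every reduced odd circuit $(A,\beta)\in R(\mathcal{A},\mathcal{B})$ (with $m=m_{A,\beta}=\lceil\log_2 p_{A,\beta}\rceil$), (1) $\begin{pmatrix} y^{A,\beta}_{k-1,2i-1} & y^{A,\beta}_{k,i} \\ y^{A,\beta}_{k,i} & y^{A,\beta}_{k-1,2i} \end{pmatrix}\succeq0$ for $2\le k\le m-1$ and all $i\in[2^{m-k}]$; (2) $\begin{pmatrix} y^{A,\beta}_{m-1,1} & y^{A,\beta}_\beta \\ y^{A,\beta}_\beta & y^{A,\beta}_{m-1,2} \end{pmatrix}\succeq0$; (3) $\begin{pmatrix} u & y^{A,\beta}_{1,l} \\ y^{A,\beta}_{1,l} & w \end{pmatrix}\succeq0$ for $l\in[2^{m-1}]$ and $u,w\in\{v_\alpha:\alpha\in A\}\cup\{y^{A,\beta}_\beta\}$, such that over all these blocks $v_\alpha$ appears $(p_{A,\beta})_\alpha$ times for each $\alpha\in A$ and $y^{A,\beta}_\beta$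 appears $2^m-p_{A,\beta}$ times; (4) $\|v_\beta\|_2\le y^{A,\beta}_\beta$ (that is, $|v_\beta|\le y^{A,\beta}_\beta$); and, for every reduced even circuit $(A,\beta)\in R(\mathcal{A},\mathcal{A})$, the condition $C^*_{A,\beta}(\mathbf{v}_{|A},v_\beta,\mathbf{y}^{A,\beta})\succeq0$, where $C^*_{A,\beta}$ is the dual circuit matrix.
   Context: $\mathbb{N}=\{0,1,2,\dots\}$, $[r]=\{1,\dots,r\}$, $\succeq 0$ means positive semidefinite, $\mathbf{v}_{|S}$ denotes restriction to coordinates indexed by $S$. $\mathcal{S}$-cone: let $\mathbb{R}[\mathcal{A},\mathcal{B}]$ be the space of functions $f(\mathbf{x})=\sum_{\alpha\in\mathcal{A}}c_\alpha|\mathbf{x}|^\alpha+\sum_{\beta\in\mathcal{B}}c_\beta\mathbf{x}^\beta$ with real coefficients, where $|\mathbf{x}|^\alpha=\prod_j|x_j|^{\alpha_j}$ (set to $\infty$ if some $x_j=0$ has negative exponent), $\mathbf{x}^\beta=\prod_jx_j^{\beta_j}$. $f$ is an even AG function if at most one $c_\alpha$ ($\alpha\in\mathcal{A}$) is negative and all $c_\beta$ ($\beta\in\mathcal{B}$) are zero; an odd AG function if all $c_\alpha$ ($\alpha\in\mathcal{A}$) are non-negative and at most one $c_\beta$ ($\beta\in\mathcal{B}$) is nonzero; an AG function if it is one of these. $C_{\mathcal{S}}(\mathcal{A},\mathcal{B})$ is the conic hull of all AG functions in $\mathbb{R}[\mathcal{A},\mathcal{B}]$ that are non-negative on $\mathbb{R}^n$;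 it is called rational if $\mathcal{A}\subseteq\mathbb{Q}^n$. The dual cone is $C_{\mathcal{S}}(\mathcal{A},\mathcal{B})^*=\{\mathbf{v}\in\mathbb{R}^{\mathcal{A}\cup\mathcal{B}}:\sum_{\gamma\in\mathcal{A}\cup\mathcal{B}}v_\gamma c_\gamma\ge0\text{ for all }f\in C_{\mathcal{S}}(\mathcal{A},\mathcal{B})\text{ with coefficient vector }\mathbf{c}\}$. Reduced circuits: for finite $\mathcal{C}\subseteq\mathbb{R}^n$, $R(\mathcal{A},\mathcal{C})$ is the set of pairs $(A,\beta)$ with $A\subseteq\mathcal{A}$ affinely independent, $\beta\in\operatorname{relint}(\operatorname{conv}A)\cap(\mathcal{C}\setminus A)$ and $(\mathcal{A}\cap\operatorname{conv}A)\setminus(A\cup\{\beta\})=\emptyset$. Elements of $R(\mathcal{A},\mathcal{A})$ are even, those of $R(\mathcal{A},\mathcal{B})$ are odd reduced circuits. For such a circuit let $\lambda_\alpha>0$ ($\alpha\in A$) be the unique barycentric coordinates, $\sum_{\alpha\in A}\lambda_\alpha\alpha=\beta$, $\sum_{\alpha\in A}\lambda_\alpha=1$; they are rational, and we write $\lambda_\alpha=(p_{A,\beta})_\alpha/p_{A,\beta}$ with $(p_{A,\beta})_\alpha,p_{A,\beta}\in\mathbb{N}$ and $p_{A,\beta}$ minimal; $m_{A,\beta}=\lceil\log_2p_{A,\beta}\rceil$. Circuit vector: for each circuit $(A,\beta)\in R(\mathcal{A},\mathcal{A}\cup\mathcal{B})$, $\mathbf{y}^{A,\beta}$ consists of real variables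 $y^{A,\beta}_{k,i}$, $k\in[m_{A,\beta}-1]$, $i\in[2^{m_{A,\beta}-k}]$, and, if the circuit is odd, one further real variable $y^{A,\beta}_\beta$. Dual circuit matrix: for a circuit $(A,\beta)$, with $m=m_{A,\beta}$, $p=p_{A,\beta}$ and $\mathbf{y}=(y_{k,i})$, $C^*_{A,\beta}(\mathbf{v}_{|A},v_\beta,\mathbf{y})$ is the block diagonal matrix with blocks (i) $\begin{pmatrix} y_{k-1,2i-1} & y_{k,i} \\ y_{k,i} & y_{k-1,2i} \end{pmatrix}$, $k\in\{2,\dots,m-1\}$, $i\in[2^{m-k}]$; (ii) $\begin{pmatrix} y_{m-1,1} & v_\beta \\ v_\beta & y_{m-1,2} \end{pmatrix}$; (iii) the singleton block $(v_\beta)$; (iv) $2^{m-1}$ blocks $\begin{pmatrix} u & y_{1,l} \\ y_{1,l} & w \end{pmatrix}$, $l\in[2^{m-1}]$, with $u,w\in\{v_\alpha:\alpha\in A\}\cup\{v_\beta\}$ such that over all blocks (iv) each $v_\alpha$ appears $(p_{A,\beta})_\alpha$ times and $v_\beta$ appears $2^m-p$ times. In (iv), and in (3) of the claim, the order of appearance does not matter.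
   Formalization: The condition v_α ≥ 0 for all α ∈ 𝒜 is added to the right-hand side (false without it: n=1, 𝒜={0}, ℬ=∅ has no reduced circuits); for m=1 the undefined y_{0,i} are read as the entries u,w and y_{1,1} as v_β (even) or y_β (odd); ∞−∞ is read as ∞. *)

(* Defs.v *)
From HB Require Import structures.
From mathcomp Require Import all_boot all_order all_algebra finmap.
From mathcomp Require Import all_classical all_reals all_analysis.
Set Implicit Arguments. Unset Strict Implicit. Unset Printing Implicit Defensive.
Import Order.TTheory GRing.Theory Num.Theory.
Import numFieldNormedType.Exports.
Local Open Scope classical_set_scope.
Local Open Scope ring_scope.

Definition conic_hull (R : realType) (V : lmodType R) (S : set V) : set V :=
  [set x | exists (k : nat) (p : 'I_k -> V) (t : 'I_k -> R),
    [/\ forall i, S (p i), forall i, 0 <= t i & x = \sum_(i < k) t i *: p i]].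

Definition affine_hull (R : realType) (V : lmodType R) (S : set V) : set V :=
  [set x | exists (k : nat) (p : 'I_k -> V) (t : 'I_k -> R),
    [/\ forall i, S (p i), \sum_(i < k) t i = 1 & x = \sum_(i < k) t i *: p i]].

Definition convex_hull (R : realType) (V : lmodType R) (S : set V) : set V :=
  [set x | exists (k : nat) (p : 'I_k -> V) (t : 'I_k -> R),
    [/\ forall i, S (p i), forall i, 0 <= t i, \sum_(i < k) t i = 1
      & x = \sum_(i < k) t i *: p i]].

Definition affinely_independent (R : realType) (V : lmodType R)
    (A : {fset V}) : Prop :=
  forall t : V -> R,
    \sum_(a <- A) t a = 0 -> \sum_(a <- A) t a *: a = 0 ->
    forall a, a \in A -> t a = 0.

Definition relint (R : realType) (n : nat) (S : set 'rV[R]_n) : set 'rV[R]_n :=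
  [set x | S x /\ within (affine_hull S) (nbhs x) S].

Definition psd (R : realType) (n : nat) (M : 'M[R]_n) : Prop :=
  M^T = M /\ forall x : 'cV[R]_n, 0 <= (x^T *m M *m x) 0 0.

Definition sym_mx2 (R : realType) (a b d : R) : 'M[R]_2 :=
  block_mx a%:M b%:M b%:M d%:M : 'M[R]_(1 + 1).

Definition block_diag (R : realType) (s : seq {k : nat & 'M[R]_k}) :=
  \mxdiag_(i < size s) tagged (tnth (in_tuple s) i).

Section SCone.
Context (R : realType) (n : nat).
Implicit Types (a b x : 'rV[R]_n) (A B C : {fset 'rV[R]_n}).

(* Vectors of R^D, for a finite set D of exponents, have type {ffun D -> R};
   [coeff c g] is c_g, with junk value 0 when g is not in D. *)
Definition coeff (D : {fset 'rV[R]_n}) (c : {ffun D -> R}) (g : 'rV[R]_n) : R :=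
  oapp c 0 (insub g).

Definition abs_monomial a x : \bar R :=
  if [exists j, (x 0 j == 0) && (a 0 j < 0)] then +oo%E
  else (\prod_j (`|x 0 j| `^ a 0 j))%:E.

(* Only used for b with entries in N, where truncn (b 0 j) is b 0 j itself. *)
Definition monomial b x : R := \prod_j x 0 j ^+ Num.truncn (b 0 j).

(* An element f of R[A, B] is identified with its coefficient vector c (the
   generating functions are linearly independent when A and B are disjoint).
   The sum is the dual addition of the extended reals, for which
   +oo + -oo = +oo, and 0 * +oo = 0: only at points with a zero coordinate can
   infinite terms of both signs meet, and such a point puts no constraint on
   the non-negativity of f.  With the other convention (+oo + -oo = -oo) the
   function (1 - |x|^-1)^2 = 1 - 2|x|^-1 + |x|^-2 would not be non-negative. *)
Definition fun_of_coeffs A B (c : {ffun (A `|` B)%fset -> R}) x : \bar R :=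
  (\sum_(a <- A) (coeff c a)%:E * abs_monomial a x
   + \sum_(b <- B) (coeff c b * monomial b x)%:E)%dE.

Definition even_AG A B (c : {ffun (A `|` B)%fset -> R}) : Prop :=
  (forall a a', a \in A -> a' \in A ->
     coeff c a < 0 -> coeff c a' < 0 -> a = a') /\
  (forall b, b \in B -> coeff c b = 0).

Definition odd_AG A B (c : {ffun (A `|` B)%fset -> R}) : Prop :=
  (forall a, a \in A -> 0 <= coeff c a) /\
  (forall b b', b \in B -> b' \in B ->
     coeff c b != 0 -> coeff c b' != 0 -> b = b').

Definition AG A B (c : {ffun (A `|` B)%fset -> R}) : Prop :=
  even_AG c \/ odd_AG c.

Definition S_cone A B : set {ffun (A `|` B)%fset -> R} :=
  conic_hull [set c | AG c /\ forall x, (0 <= fun_of_coeffs c x)%E].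

Definition dual_S_cone A B : set {ffun (A `|` B)%fset -> R} :=
  [set v | forall c, @S_cone A B c -> 0 <= \sum_g v g * c g].

(* [reduced_circuit AA C A b] is (A, b) \in R(AA, C). *)
Definition reduced_circuit (AA C A : {fset 'rV[R]_n}) (b : 'rV[R]_n) : Prop :=
  [/\ (A `<=` AA)%fset,
      affinely_independent A,
      relint (convex_hull [set` A]) b,
      b \in (C `\` A)%fset
    & ([set` AA] `&` convex_hull [set` A]) `\` ([set` A] `|` [set b]) = set0].

Definition barycentric A b (l : 'rV[R]_n -> R) : Prop :=
  [/\ forall a, a \in A -> 0 < l a,
      \sum_(a <- A) l a *: a = b
    & \sum_(a <- A) l a = 1].

Definition lambda A b : 'rV[R]_n -> R := xget (fun=> 0) (barycentric A b).

Definition common_denom A b (p : nat) : Prop :=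
  (0 < p)%N /\ forall a, a \in A -> p%:R * lambda A b a \is a Num.nat.

Definition circ_p A b : nat :=
  xget 0%N [set p | common_denom A b p /\
                    forall q, common_denom A b q -> (p <= q)%N].

Definition circ_num A b a : nat := Num.truncn ((circ_p A b)%:R * lambda A b a).

Definition circ_m A b : nat := up_log 2 (circ_p A b).

(* An order of appearance of the entries u, w in the 2^(m-1) blocks of level 1:
   the l-th block has on its diagonal the entries number 2l-1 and 2l.  An entry
   v_a is represented by its exponent a, the entry v_b (resp. y_b, for an odd
   circuit) by b, which is not in A.  The counts add up to 2^m, so that no
   other exponent occurs. *)
Definition leaf_order A b (s : seq 'rV[R]_n) : Prop :=
  [/\ size s = (2 ^ circ_m A b)%N,
      forall a, a \in A -> count_mem a s = circ_num A b a
    & count_mem b s = (2 ^ circ_m A b - circ_p A b)%N].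

(* The i-th entry (i >= 1), [top] being the value of the entry labelled b. *)
Definition leaf (v : 'rV[R]_n -> R) b (top : R) (s : seq 'rV[R]_n) (i : nat) : R :=
  let g := nth b s i.-1 in if g == b then top else v g.

(* The variable y_{k,i}, for k in [m-1].  If m = 1 there is no such variable,
   but y_{0,1}, y_{0,2} and y_{1,1} occur in the blocks: level 0 stands for the
   entries u, w and level m for v_b (resp. y_b).  The blocks at levels m and 1
   then coincide. *)
Definition tree (v : 'rV[R]_n -> R) A b (top : R) (s : seq 'rV[R]_n)
    (y : nat -> nat -> R) (k i : nat) : R :=
  if k == circ_m A b then top
  else if k == 0%N then leaf v b top s i
  else y k i.

(* The block with off-diagonal entry y_{k,i}. *)
Definition inner_block v A b top s y (k i : nat) : 'M[R]_2 :=
  let t := tree v A b top s y in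
  sym_mx2 (t k.-1 (2 * i).-1) (t k i) (t k.-1 (2 * i)%N).

Definition root_block v A b top s y : 'M[R]_2 :=
  let t := tree v A b top s y in let m := circ_m A b in
  sym_mx2 (t m.-1 1%N) top (t m.-1 2%N).

Definition leaf_block v A b top s y (l : nat) : 'M[R]_2 :=
  sym_mx2 (leaf v b top s (2 * l).-1) (tree v A b top s y 1 l)
          (leaf v b top s (2 * l)%N).

Definition dual_circuit_mx (v : 'rV[R]_n -> R) A b
    (s : seq 'rV[R]_n) (y : nat -> nat -> R) :=
  let m := circ_m A b in
  let blk k (M : 'M[R]_k) : {k : nat & 'M[R]_k} := Tagged (fun k => 'M[R]_k) M in
  block_diag
    ([seq blk _ (inner_block v A b (v b) s y k i)
        | k <- iota 2 (m - 2), i <- iota 1 (2 ^ (m - k))]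
     ++ [:: blk _ (root_block v A b (v b) s y); blk 1%N (v b)%:M]
     ++ [seq blk _ (leaf_block v A b (v b) s y l) | l <- iota 1 (2 ^ m.-1)]).

(* yb is the additional variable y_b of an odd circuit. *)
Definition odd_circuit_cond (v : 'rV[R]_n -> R) A b
    (s : seq 'rV[R]_n) (y : nat -> nat -> R) (yb : R) : Prop :=
  let m := circ_m A b in
  [/\ forall k i, (2 <= k <= m.-1)%N -> (1 <= i <= 2 ^ (m - k))%N ->
        psd (inner_block v A b yb s y k i),
      psd (root_block v A b yb s y),
      forall l, (1 <= l <= 2 ^ m.-1)%N -> psd (leaf_block v A b yb s y l)
    & `|v b| <= yb].

End SCone.

Arguments S_cone {R n} A B.
Arguments dual_S_cone {R n} A B.

(* Main.v *)
Require Import Defs.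
From HB Require Import structures.
From mathcomp Require Import all_boot all_order all_algebra finmap.
From mathcomp Require Import all_classical all_reals all_analysis.
From mathcomp Require Import ring lra zify.
Import Order.TTheory GRing.Theory Num.Theory.
Import numFieldNormedType.Exports.
Local Open Scope classical_set_scope.
Local Open Scope ring_scope.
Set Implicit Arguments.
Unset Strict Implicit.
Unset Printing Implicit Defensive.

(** The blocks attached to a circuit (A, b) form a binary tree in which every
    node is at most the geometric mean of its children; such a tree with root
    t exists if and only if t <= prod_a v_a^(lambda_a).  This inequality holds
    on the dual cone because, by AM-GM,
    sum_a lambda_a w_a |x|^a - (prod_a w_a^(lambda_a)) |x|^b is a non-negative
    AG function for all w > 0, and similarly with +- x^b.

    Conversely, replacing v_a by v_a + e (and v_b by |v_b| + e) preserves these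
    inequalities, which then say that f = ln v satisfies
    f(b) <= sum_a lambda_a f(a) on the reduced circuits.  An exchange argument
    extends this to all convex combinations of points of AA, so Farkas' lemma
    gives an affine function below f on AA minus b and above f at b, that is,
    a point y > 0 and a scaling s with s y^a <= v_a + e and
    s y^b >= |v_b| + e.  Evaluating a non-negative AG function with
    distinguished exponent b at y, up to signs, bounds its pairing with v from
    below; finally e tends to 0. *)

(** * Inequalities *)

(** The numbers p and m enter because the weights are rational: raising the inequality to the power
    p turns the weighted geometric mean into a product of p entries. A binary tree needs 2^m leaves,
    so the remaining 2^m - p of them carry the value of the root itself, and this padding cancels
    from both sides.

    The obstacle in the converse is that the blocks see only reduced circuits, whereas a
    non-negative AG function may involve b together with any points of [AA] around it. The exchange
    argument closes this gap; it terminates because every exchange keeps the number of vertices and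
    expels a point of [AA] from the hull.

    Entries of v that vanish have no logarithm, hence the shift by e. It is harmless because a
    weighted geometric mean is superadditive: a common shift of the entries raises the mean by at
    least as much.

    For odd circuits both signs of x^b occur. Conversely, b has an odd coordinate, so flipping the
    sign of one coordinate of the evaluation point makes the term of x^b negative whatever the sign
    of its coefficient. *)

Lemma separating_real (R : realDomainType) (l u : seq R) :
  (forall x y, x \in l -> y \in u -> x <= y) ->
  exists t, (forall x, x \in l -> x <= t) /\ (forall y, y \in u -> t <= y).
Proof.
elim: l => [|x l IHl] lu.
  elim: u {lu} => [|y u [t [_ tu]]]; first by exists 0.
  exists (Num.min y t); split=> // z; rewrite inE ge_min => /predU1P[->|/tu ->].
    by rewrite lexx.
  by rewrite orbT.
have [x' y' x'l y'u|t [lt tu]] := IHl; first by apply: lu; rewrite // inE x'l orbT.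
exists (Num.max x t); split=> [z|y yu].
  by rewrite inE le_max => /predU1P[->|/lt ->]; rewrite ?lexx ?orbT.
by rewrite ge_max lu ?tu // inE eqxx.
Qed.

(* P is a convex cone containing S: it plays the role of the set of
   consequences of S. *)
Lemma fourier_motzkin (R : realFieldType) (n : nat) (P : 'rV[R]_n -> R -> Prop)
    (PD : forall u g u' g', P u g -> P u' g' -> P (u + u') (g + g'))
    (PZ : forall c u g, 0 < c -> P u g -> P (c *: u) (c * g))
    (k : nat) (S : seq ('rV[R]_n * R)) :
  (forall s, s \in S -> P s.1 s.2) ->
  (forall s (j : 'I_n), s \in S -> (k <= j)%N -> s.1 0 j = 0) ->
  (exists y : 'I_n -> R, forall s, s \in S -> \sum_j s.1 0 j * y j <= s.2) \/
  (exists2 g, g < 0 & P 0 g).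
Proof.
elim: k S => [|k IH] S SP S0.
  have [/allP Sge|/allPn[s sS]] := boolP (all (fun s => 0 <= s.2) S).
    left; exists (fun=> 0) => s sS.
    by rewrite big1 ?Sge // => j _; rewrite mulr0.
  rewrite -ltNge => slt; right; exists s.2 => //.
  suff <- : s.1 = 0 by exact: SP.
  by apply/rowP => j; rewrite mxE S0.
have [nk|kn] := leqP n k.
  by apply: IH => // s j sS kj; move: (leq_trans nk kj); rewrite leqNgt ltn_ord.
pose i := Ordinal kn.
pose Z := [seq s : 'rV[R]_n * R <- S | s.1 0 i == 0].
pose Sp := [seq s : 'rV[R]_n * R <- S | 0 < s.1 0 i].
pose Sn := [seq s : 'rV[R]_n * R <- S | s.1 0 i < 0].
(* An upper bound p and a lower bound q on variable i, combined with positive factors so that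
   coordinate i cancels. *)
pose comb (p q : 'rV[R]_n * R) :=
  ((- q.1 0 i) *: p.1 + p.1 0 i *: q.1, (- q.1 0 i) * p.2 + p.1 0 i * q.2).
have [||[y Hy]|] := IH (Z ++ [seq comb p q | p <- Sp, q <- Sn]); last by right.
- move=> s; rewrite mem_cat => /orP[|/allpairsP[[p q] /=]].
    by rewrite mem_filter => /andP[_ /SP].
  rewrite !mem_filter => -[/andP[p0 pS] /andP[q0 qS] ->] /=.
  by apply: PD; apply: PZ; rewrite ?oppr_gt0 //; apply: SP.
- move=> s j; rewrite mem_cat => /orP[|/allpairsP[[p q] /=]].
    rewrite mem_filter => /andP[/eqP si sS].
    rewrite leq_eqVlt => /predU1P[kj|]; last exact: S0.
    by rewrite -[RHS]si; congr (s.1 0 _); apply/val_inj.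
  rewrite !mem_filter => -[/andP[p0 pS] /andP[q0 qS] ->] /=.
  rewrite leq_eqVlt => /predU1P[kj|kj].
    have -> : j = i by apply/val_inj.
    by rewrite !mxE; ring.
  by rewrite !mxE (S0 p j) // (S0 q j) // !mulr0 addr0.
(* [D s] is the slack of s at y. Increasing variable i by t respects s when t lies on the correct
   side of [D s / s.1 0 i]; the combined rows say that all lower bounds on t are below all upper
   bounds. *)
- pose D (s : 'rV[R]_n * R) := s.2 - \sum_j s.1 0 j * y j.
  have [x z|t [tl tu]] := @separating_real R
    [seq D q / q.1 0 i | q <- Sn] [seq D p / p.1 0 i | p <- Sp].
    move=> /mapP[q qn ->] /mapP[p pp ->].
    have /Hy /= : comb p q \in Z ++ [seq comb p q | p <- Sp, q <- Sn].
      by rewrite mem_cat; apply/orP; right; apply/allpairsP; exists (p, q).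
    move: qn pp; rewrite !mem_filter => /andP[q0 _] /andP[p0 _].
    have -> : \sum_j ((- q.1 0 i) *: p.1 + p.1 0 i *: q.1) 0 j * y j =
      (- q.1 0 i) * (\sum_j p.1 0 j * y j) + p.1 0 i * (\sum_j q.1 0 j * y j).
      rewrite !mulr_sumr -big_split; apply: eq_bigr => j _ /=; rewrite !mxE; ring.
    move=> h; rewrite ler_pdivlMr // mulrAC ler_ndivrMr // /D; lra.
  left; exists (fun j => y j + (j == i)%:R * t) => s sS.
  have -> : \sum_j s.1 0 j * (y j + (j == i)%:R * t) =
            \sum_j s.1 0 j * y j + s.1 0 i * t.
    under eq_bigr do rewrite mulrDr; rewrite big_split /=; congr (_ + _).
    rewrite (bigD1 i) //= eqxx mul1r big1 ?addr0 // => j /negbTE ->.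
    by rewrite mul0r mulr0.
  have [s0|s0|s0] := ltgtP (s.1 0 i) 0.
  + have /tl : D s / s.1 0 i \in [seq D q / q.1 0 i | q <- Sn].
      by apply: map_f; rewrite mem_filter s0.
    by rewrite ler_ndivrMr // /D; lra.
  + have /tu : D s / s.1 0 i \in [seq D q / q.1 0 i | q <- Sp].
      by apply: map_f; rewrite mem_filter s0.
    by rewrite ler_pdivlMr // /D; lra.
  + have /Hy : s \in Z ++ [seq comb p q | p <- Sp, q <- Sn].
      by rewrite mem_cat mem_filter s0 eqxx sS.
    by rewrite s0 mul0r addr0.
Qed.

(** Elimination is run with the predicate that records non-negative combinations of the given rows,
    so a contradictory row carries its multipliers. The field is arbitrary because the alternative
    is used over the rationals as well as over the reals. *)
Lemma farkas (R : realFieldType) (n : nat) (I : eqType) (s : seq I)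
    (u : I -> 'rV[R]_n) (g : I -> R) :
  uniq s ->
  (exists y : 'I_n -> R, forall i, i \in s -> \sum_j u i 0 j * y j <= g i) \/
  (exists w : I -> R, [/\ forall i, 0 <= w i, \sum_(i <- s) w i *: u i = 0
     & \sum_(i <- s) w i * g i < 0]).
Proof.
move=> us.
pose P v c := exists w : I -> R, [/\ forall i, 0 <= w i,
  v = \sum_(i <- s) w i *: u i & c = \sum_(i <- s) w i * g i].
have [||||[y Hy]|[c c0 [w [w0 e1 e2]]]] :=
  @fourier_motzkin R n P _ _ n [seq (u i, g i) | i <- s].
- move=> _ _ _ _ [w [w0 -> ->]] [w' [w'0 -> ->]]; exists (fun i => w i + w' i).
  split=> [i||]; rewrite ?addr_ge0 // -big_split; apply: eq_bigr => i _ /=.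
    by rewrite scalerDl.
  by rewrite mulrDl.
- move=> c _ _ c0 [w [w0 -> ->]]; exists (fun i => c * w i).
  split=> [i||]; first by rewrite mulr_ge0 // ltW.
    by rewrite scaler_sumr; apply: eq_bigr => i _; rewrite scalerA.
  by rewrite mulr_sumr; apply: eq_bigr => i _; rewrite mulrA.
- move=> _ /mapP[i si ->] /=; exists (fun j => (j == i)%:R); split=> [j||].
  + by rewrite ler0n.
  + rewrite (bigD1_seq i) //= eqxx scale1r big1 ?addr0 // => j /negbTE ->.
    by rewrite scale0r.
  + rewrite (bigD1_seq i) //= eqxx mul1r big1 ?addr0 // => j /negbTE ->.
    by rewrite mul0r.
- by move=> x j _; rewrite leqNgt ltn_ord.
- by left; exists y => i si; apply: (Hy (u i, g i)); apply: map_f.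
- by right; exists w; rewrite -e1 -e2.
Qed.

(** With base 0, [powR] is 1 at exponent 0 and 0 at every other exponent, negative ones included.
    Exponents of opposite signs could then cancel on the left only, which explains the alternative
    in the hypothesis. *)
Lemma powR_sumr (R : realType) (T : eqType) (s : seq T) (l : T -> R) (r : R) :
  0 <= r -> (forall i, i \in s -> 0 <= l i) \/ 0 < r ->
  r `^ (\sum_(i <- s) l i) = \prod_(i <- s) r `^ l i.
Proof.
move=> r0 [l0|rp]; last first.
  elim: s => [|i s IH]; first by rewrite !big_nil powRr0.
  by rewrite !big_cons powRD ?IH // (gt_eqF rp) implybT.
elim: s l0 => [|i s IH] l0; first by rewrite !big_nil powRr0.
have ls j : j \in s -> 0 <= l j by move=> sj; apply: l0; rewrite inE sj orbT.
have li : 0 <= l i by apply: l0; rewrite mem_head.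
rewrite !big_cons -IH //.
have Sl : 0 <= \sum_(j <- s) l j by rewrite big_seq sumr_ge0.
have [e0|ne0] := eqVneq (l i + \sum_(j <- s) l j) 0.
  move/eqP: (e0); rewrite paddr_eq0 // => /andP[/eqP le /eqP se].
  by rewrite le se addr0 !powRr0 mulr1.
by rewrite powRD // (negbTE ne0).
Qed.

Lemma powR_prod (R : realType) (I : Type) (s : seq I) (F : I -> R) (r : R) :
  (forall i, 0 <= F i) -> (\prod_(i <- s) F i) `^ r = \prod_(i <- s) F i `^ r.
Proof.
move=> F0; elim: s => [|i s IH]; first by rewrite !big_nil powR1.
by rewrite !big_cons powRM ?IH // prodr_ge0.
Qed.

Section AMGM.
Context (R : realType) (I : eqType) (s : seq I) (l : I -> R).
Hypotheses (l0 : forall i, i \in s -> 0 < l i) (l1 : \sum_(i <- s) l i = 1).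

(** The tangent inequality ln u <= u - 1 is applied to u = z_i / S, where S is the arithmetic mean;
    weighted by l_i, the right-hand sides add up to 0. *)
Lemma weighted_AMGM (z : I -> R) : (forall i, i \in s -> 0 <= z i) ->
  \prod_(i <- s) z i `^ l i <= \sum_(i <- s) l i * z i.
Proof.
move=> z0.
have S0 : 0 <= \sum_(i <- s) l i * z i.
  by rewrite big_seq sumr_ge0 // => i si; rewrite mulr_ge0 ?z0 // ltW ?l0.
have [/hasP[i si /eqP zi]|/hasPn zn] := boolP (has (fun i => z i == 0) s).
  rewrite (big_rem i) //= zi powR0 ?mul0r // gt_eqF //; exact: l0.
have zp i : i \in s -> 0 < z i by move=> si; rewrite lt_neqAle z0 // eq_sym zn.
set S := \sum_(i <- s) l i * z i in S0 *.
have Sp : 0 < S.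
  rewrite lt_neqAle S0 andbT eq_sym; apply/eqP => SE.
  have /eqP := l1; rewrite big_seq big1 ?[0 == 1]eq_sym ?oner_eq0 // => i si.
  move/eqP: SE; rewrite /S (big_rem i) //= paddr_eq0 ?mulr_ge0 ?z0 ?(ltW (l0 si)) //.
    by rewrite mulf_eq0 [z i == 0]gt_eqF ?zp // orbF => /andP[/eqP].
  rewrite big_seq sumr_ge0 // => j /mem_rem sj.
  by rewrite mulr_ge0 ?z0 ?(ltW (l0 sj)).
have -> : \prod_(i <- s) z i `^ l i = expR (\sum_(i <- s) l i * ln (z i)).
  rewrite expR_sum big_seq [RHS]big_seq; apply: eq_bigr => i si.
  by rewrite /powR gt_eqF ?zp.
rewrite -[leRHS]lnK ?posrE // ler_expR.
have -> : ln S = \sum_(i <- s) l i * ln S by rewrite -mulr_suml l1 mul1r.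
rewrite -subr_le0 -sumrB.
have S1 : \sum_(i <- s) l i * (z i / S - 1) = 0.
  under eq_bigr do rewrite mulrBr mulr1 mulrA.
  by rewrite sumrB -mulr_suml -/S divff ?gt_eqF // l1 subrr.
rewrite -[leRHS]S1 big_seq [leRHS]big_seq; apply: ler_sum => i si.
rewrite -mulrBr ler_wpM2l ?(ltW (l0 si)) // -ln_div ?posrE ?zp //.
have := @le_ln1Dx R (z i / S - 1).
by rewrite (addrC 1) subrK; apply; rewrite ltrBrDl subrr divr_gt0 ?zp.
Qed.

(** Divide by the geometric mean of the z_i + e and apply AM-GM to the quotients z_i / (z_i + e) and
    e / (z_i + e), which add up to 1 for each i. *)
Lemma geom_mean_addr (z : I -> R) (e : R) : (forall i, i \in s -> 0 <= z i) ->
  0 < e -> \prod_(i <- s) z i `^ l i + e <= \prod_(i <- s) (z i + e) `^ l i.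
Proof.
move=> z0 e0.
have up i : i \in s -> 0 < z i + e by move=> si; rewrite ltr_wpDl ?z0.
have quot (x : I -> R) : (forall i, i \in s -> 0 <= x i) ->
    \prod_(i <- s) x i `^ l i <=
    (\prod_(i <- s) (z i + e) `^ l i) * \sum_(i <- s) l i * (x i / (z i + e)).
  move=> x0.
  have -> : \prod_(i <- s) x i `^ l i = (\prod_(i <- s) (z i + e) `^ l i) *
      \prod_(i <- s) (x i / (z i + e)) `^ l i.
    rewrite -big_split big_seq [RHS]big_seq; apply: eq_bigr => i si /=.
    rewrite -powRM ?divr_ge0 ?x0 ?(ltW (up i si)) //.
    rewrite mulrCA divff ?mulr1 //; exact: lt0r_neq0 (up i si).
  rewrite ler_wpM2l //; first by rewrite prodr_ge0 // => i _; rewrite powR_ge0.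
  by apply: weighted_AMGM => i si; rewrite divr_ge0 ?x0 // ltW ?up.
have eE : \prod_(i <- s) e `^ l i = e.
  by rewrite -powR_sumr ?l1 ?powRr1 ?(ltW e0) //; right.
rewrite -{1}eE.
apply: le_trans (lerD (quot z z0) (quot (fun=> e) (fun _ _ => ltW e0))) _.
rewrite -mulrDr -big_split /= -[leRHS]mulr1 le_eqVlt.
apply/orP; left; apply/eqP; congr (_ * _).
rewrite -[RHS]l1 big_seq [RHS]big_seq; apply: eq_bigr => i si.
by rewrite -mulrDr -mulrDl divff ?mulr1 // gt_eqF ?up.
Qed.

End AMGM.

(** * Block matrices *)

Lemma psd_sym_mx2 (R : realType) (a b d : R) :
  psd (sym_mx2 a b d) <-> [/\ 0 <= a, 0 <= d & b ^+ 2 <= a * d].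
Proof.
have form (y z : R) : ((col_mx (y%:M : 'M[R]_1) (z%:M : 'M[R]_1))^T *m
      (sym_mx2 a b d : 'M[R]_(1 + 1)) *m
      col_mx (y%:M : 'M[R]_1) (z%:M : 'M[R]_1)) 0 0 = a * y ^+ 2 + 2 * b * y * z + d * z ^+ 2.
  rewrite /sym_mx2 tr_col_mx mul_row_block mul_row_col !tr_scalar_mx.
  rewrite -!scalar_mxM -!raddfD /= -!scalar_mxM -raddfD /= !mxE eqxx mulr1n; ring.
split=> [[_ pos]|[a0 d0 abd]].
  have {}pos y z : 0 <= a * y ^+ 2 + 2 * b * y * z + d * z ^+ 2.
    by rewrite -form; apply: pos.
  have a0 : 0 <= a by have := pos 1 0; rewrite !expr2; lra.
  have d0 : 0 <= d by have := pos 0 1; rewrite !expr2; lra.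
  split=> //; have [a1|a1] := ltP 0 a.
    (* The form at (-b, a) is a times the determinant. *)
    rewrite -subr_ge0 -(pmulr_rge0 _ a1).
    have := pos (- b) a; congr (_ <= _); ring.
  have aE : a = 0 by apply/le_anti; rewrite a0 a1.
  have [->|b1] := eqVneq b 0; first by rewrite expr0n mulr_ge0.
  (* With a = 0 and b non-zero, the form takes the value -1 at this vector. *)
  have := pos (- (d + 1) / (2 * b)) 1; rewrite aE !mul0r add0r expr1n !mulr1.
  have -> : 2 * b * (- (d + 1) / (2 * b)) = - (d + 1) by field.
  lra.
split=> [|x0].
  by rewrite /sym_mx2 (@tr_block_mx _ 1 1 1 1) !tr_scalar_mx.
pose x : 'cV[R]_(1 + 1) := x0; rewrite -[x0]/x.
rewrite -(vsubmxK x) (mx11_scalar (usubmx x)) (mx11_scalar (dsubmx x)) form.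
set y := usubmx x 0 0; set z := dsubmx x 0 0.
have [a1|a1] := ltP 0 a.
  rewrite -(pmulr_rge0 _ a1).
  have -> : a * (a * y ^+ 2 + 2 * b * y * z + d * z ^+ 2) =
    (a * y + b * z) ^+ 2 + (a * d - b ^+ 2) * z ^+ 2 by ring.
  by rewrite addr_ge0 ?sqr_ge0 // mulr_ge0 ?sqr_ge0 // subr_ge0.
have aE : a = 0 by apply/le_anti; rewrite a0 a1.
have /eqP : b ^+ 2 = 0 by apply/le_anti; rewrite sqr_ge0 andbT (le_trans abd) // aE mul0r.
rewrite sqrf_eq0 => /eqP ->; rewrite aE mulr0 !mul0r !add0r.
by rewrite mulr_ge0 ?sqr_ge0.
Qed.

Lemma psd_mx11 (R : realType) (a : R) : psd (a%:M : 'M[R]_1) <-> 0 <= a.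
Proof.
split=> [[_ /(_ 1%:M)]|a0].
  by rewrite tr_scalar_mx mul1mx mulmx1 mxE eqxx mulr1n.
split=> [|x]; first exact: tr_scalar_mx.
rewrite (mx11_scalar x) tr_scalar_mx -!scalar_mxM mxE eqxx mulr1n.
by rewrite mulrAC mulr_ge0 // -expr2 sqr_ge0.
Qed.

Lemma psd_block_diag (R : realType) (s : seq {k : nat & 'M[R]_k}) :
  psd (block_diag s) <-> forall B, B \in s -> psd (tagged B).
Proof.
have form (x : forall i : 'I_(size s), 'cV[R]_(tag (tnth (in_tuple s) i))) :
    (\mxcol_i x i)^T *m block_diag s *m (\mxcol_i x i) =
    \sum_i (x i)^T *m tagged (tnth (in_tuple s) i) *m x i.
  by rewrite tr_mxcol -mulmxA mul_mxdiag_mxcol mul_mxrow_mxcol;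
     apply: eq_bigr => i _; rewrite mulmxA.
split=> [[sym pos] B /(tnthP (in_tuple s))[i ->]|psds].
  split; first by move: sym; rewrite /block_diag tr_mxdiag => /eq_mxdiagP.
  move=> x.
  (* The vector x in block i and 0 elsewhere. Block sizes depend on j, so x is transported by
     [conform_mx], which is the identity at j = i. *)
  pose y j : 'cV[R]_(tag (tnth (in_tuple s) j)) := conform_mx 0 x *+ (j == i).
  have := pos (\mxcol_j y j); rewrite form (bigD1 i) //= big1 => [|j ji].
    by rewrite addr0 /y eqxx mulr1n conform_mx_id.
  by rewrite /y (negbTE ji) mulr0n mulmx0.
split=> [|x].
  rewrite /block_diag tr_mxdiag; apply: eq_mxdiag => i.
  by have [] := psds _ (mem_tnth i (in_tuple s)).
rewrite -[x]submxcolK form summxE sumr_ge0 // => i _.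
by have [_] := psds _ (mem_tnth i (in_tuple s)); apply.
Qed.

(** * Binary trees of 2x2 blocks and geometric means *)

Section Tree.
Context (R : realType).
Implicit Types (t : nat -> nat -> R) (m k i : nat).

(** Leaves sit at level 0 and the root is node 1 of level m. Nodes are numbered from 1, so that the
    children of i are 2i - 1 and 2i. *)
Definition tree_psd t m := forall k i, (1 <= k <= m)%N -> (1 <= i <= 2 ^ (m - k))%N ->
  psd (sym_mx2 (t k.-1 (2 * i).-1) (t k i) (t k.-1 (2 * i)%N)).

(** The leaves below node i of level k + 1 are those below its two children; [(2 * i).-2] is the
    predecessor of the child 2i - 1. *)
Lemma prod_double k i (F : nat -> R) : (0 < i)%N ->
  \prod_(j < 2 ^ k.+1) F ((i.-1 * 2 ^ k.+1) + j)%N =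
  \prod_(j < 2 ^ k) F (((2 * i).-2 * 2 ^ k) + j)%N *
  \prod_(j < 2 ^ k) F (((2 * i).-1 * 2 ^ k) + j)%N.
Proof.
move=> i0; have -> : (2 ^ k.+1 = 2 ^ k + 2 ^ k)%N by rewrite expnS mul2n addnn.
rewrite big_split_ord /=; congr (_ * _); apply: eq_bigr => j _; congr F; nia.
Qed.

(** Induction on the level: the square of a node is at most the product of its children, and the
    power 2^k of that bound is controlled by the leaves below each child. *)
Lemma tree_psd_le_prod t m k i : tree_psd t m ->
  (k <= m)%N -> (1 <= i <= 2 ^ (m - k))%N -> (k == 0%N) || (0 <= t k i) ->
  t k i ^+ (2 ^ k) <= \prod_(j < 2 ^ k) t 0 (i.-1 * 2 ^ k + j).+1.
Proof.
move=> tp; elim: k i => [|k IH] i km im t0.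
  by rewrite expn0 big_ord1 expr1 muln1 addn0 prednK //; case/andP: im.
have i0 : (0 < i)%N by case/andP: im.
have im' : (2 * i <= 2 ^ (m - k))%N.
  by rewrite -(subnSK km) expnS leq_mul2l /=; case/andP: im.
have /psd_sym_mx2[/= u0 w0 tuw] := tp k.+1 i km im.
have IH1 := IH (2 * i).-1 (ltnW km); have IH2 := IH (2 * i)%N (ltnW km).
rewrite (@prod_double k i (fun j => t 0%N j.+1) i0) expnS exprM.
apply: le_trans (_ : (t k (2 * i).-1 * t k (2 * i)) ^+ (2 ^ k) <= _).
  by rewrite lerXn2r // nnegrE ?sqr_ge0 ?mulr_ge0.
rewrite exprMn; apply: ler_pM; rewrite ?exprn_ge0 //.
  by apply: IH1; rewrite ?u0 ?orbT //; lia.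
by apply: IH2; rewrite ?w0 ?orbT //; lia.
Qed.

(** The extremal tree over the leaves [L]: every node is exactly the geometric mean of its
    children. *)
Fixpoint sqrt_tree (L : nat -> R) k i : R := if k is k'.+1 then
  Num.sqrt (sqrt_tree L k' (2 * i).-1 * sqrt_tree L k' (2 * i)) else L i.

Lemma sqrt_tree_ge0 L k i : (forall i, 0 <= L i) -> 0 <= sqrt_tree L k i.
Proof. by case: k => [|k] L0 /=; rewrite ?sqrtr_ge0. Qed.

Lemma sqrt_treeX L k i : (forall i, 0 <= L i) -> (0 < i)%N ->
  sqrt_tree L k i ^+ (2 ^ k) = \prod_(j < 2 ^ k) L (i.-1 * 2 ^ k + j).+1.
Proof.
move=> L0; elim: k i => [|k IH] i i0.
  by rewrite expn0 big_ord1 expr1 muln1 addn0 prednK.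
rewrite (@prod_double k i (fun j => L j.+1) i0) expnS exprM /=.
rewrite sqr_sqrtr ?mulr_ge0 ?sqrt_tree_ge0 //.
by rewrite exprMn !IH //; lia.
Qed.

(** Below the root the determinants vanish by construction. Only the root, replaced by [top], has to
    be checked, and there the bound on the product of all leaves is the required one after a root of
    order 2^(m-1). *)
Lemma sqrt_tree_psd L m (top : R) : (0 < m)%N -> (forall i, 0 <= L i) -> 0 <= top ->
  top ^+ (2 ^ m) <= \prod_(j < 2 ^ m) L j.+1 ->
  tree_psd (fun k i => if k == m then top else
                       if k == 0%N then L i else sqrt_tree L k i) m.
Proof.
move=> m0 L0 top0 topL k i /andP[k0 km] /andP[i0 im].
have tE i' : (if k.-1 == m then top else if k.-1 == 0%N then L i'
    else sqrt_tree L k.-1 i') = sqrt_tree L k.-1 i'.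
  by rewrite ltn_eqF ?prednK //; case: (k.-1).
apply/psd_sym_mx2; rewrite !tE; split; rewrite ?sqrt_tree_ge0 //.
case: k k0 km im {tE} => // k _ km im /=.
have [kE|_] := eqVneq k.+1 m; last first.
  by rewrite sqr_sqrtr ?mulr_ge0 ?sqrt_tree_ge0.
have iE : i = 1%N by move: im; rewrite kE subnn expn0 => im; lia.
move: topL; rewrite -kE iE.
have := @prod_double k 1 (fun j => L j.+1) isT; rewrite mul0n => ->.
have := @sqrt_treeX L k 1 L0 isT; have := @sqrt_treeX L k 2 L0 isT => /= <- <-.
by rewrite -exprMn expnS exprM ler_pXn2r ?expn_gt0 ?nnegrE ?sqr_ge0
  ?mulr_ge0 ?sqrt_tree_ge0.
Qed.

End Tree.

(** * The blocks of a circuit as one tree *)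

Section CircuitBlocks.
Context (R : realType) (n : nat).
Variables (v : 'rV[R]_n -> R) (A : {fset 'rV[R]_n}) (b : 'rV[R]_n).
Variable s : seq 'rV[R]_n.
Local Notation m := (circ_m A b).
Local Notation p := (circ_p A b).
Hypothesis m0 : (0 < m)%N.

(** Inner, root and leaf blocks are the levels 2 to m - 1, m and 1 of a single tree; [m0] keeps the
    root apart from the leaves. *)
Lemma tree_psdP top y : tree_psd (tree v A b top s y) m <->
  [/\ forall k i, (2 <= k <= m.-1)%N -> (1 <= i <= 2 ^ (m - k))%N ->
        psd (inner_block v A b top s y k i),
      psd (root_block v A b top s y) &
      forall l, (1 <= l <= 2 ^ m.-1)%N -> psd (leaf_block v A b top s y l)].
Proof.
have t0 i : tree v A b top s y 0 i = leaf v b top s i.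
  by rewrite /tree eq_sym gtn_eqF.
have tm i : tree v A b top s y m i = top by rewrite /tree eqxx.
have rootE : root_block v A b top s y = inner_block v A b top s y m 1.
  by rewrite /root_block /inner_block /= tm.
have leafE l : leaf_block v A b top s y l = inner_block v A b top s y 1 l.
  by rewrite /leaf_block /inner_block /= !t0.
split=> [tp|[inner root lf] k i /andP[k0 km] im].
  split=> [k i km im|| l lm]; first by apply: tp => //; lia.
    by rewrite rootE; apply: tp; rewrite ?m0 ?leqnn ?subnn.
  by rewrite leafE; apply: tp; rewrite ?subn1 //= m0.
have [kE|km'] := eqVneq k m.
  have iE : i = 1%N by move: im; rewrite kE subnn expn0; lia.
  by rewrite kE iE -[sym_mx2 _ _ _]/(inner_block v A b top s y m 1) -rootE.
have [kE|k1] := eqVneq k 1%N.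
  rewrite kE -[sym_mx2 _ _ _]/(inner_block v A b top s y 1 i) -leafE.
  by apply: lf; move: im; rewrite kE subn1.
by apply: inner => //; lia.
Qed.

Lemma psd_dual_circuit_mx y : psd (dual_circuit_mx v A b s y) <->
  0 <= v b /\ tree_psd (tree v A b (v b) s y) m.
Proof.
rewrite /dual_circuit_mx psd_block_diag tree_psdP; split=> [P|[vb [inner root lf]] B].
  split; first by apply/psd_mx11; apply: (P (Tagged (fun k => 'M[R]_k) (v b)%:M));
    rewrite !mem_cat !inE eqxx !orbT.
  split=> [k i km im|| l lm].
  - apply: (P (Tagged (fun k => 'M[R]_k) (inner_block v A b (v b) s y k i))).
    rewrite mem_cat; apply/orP; left; apply/allpairsPdep; exists k, i.
    by rewrite !mem_iota; split=> //; lia.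
  - apply: (P (Tagged (fun k => 'M[R]_k) (root_block v A b (v b) s y))).
    by rewrite !mem_cat !inE eqxx !orbT.
  - apply: (P (Tagged (fun k => 'M[R]_k) (leaf_block v A b (v b) s y l))).
    rewrite !mem_cat; apply/orP; right; apply/orP; right; apply/mapP; exists l => //.
    by rewrite mem_iota; lia.
rewrite !mem_cat => /orP[/allpairsPdep[k [i [+ + ->]]]|].
  by rewrite !mem_iota => km im; apply: inner; lia.
rewrite !inE => /orP[/orP[/eqP ->|/eqP ->] //|/mapP[l + ->]].
  by apply/psd_mx11.
by rewrite mem_iota => lm; apply: lf; lia.
Qed.

Hypotheses (bA : b \notin A) (so : leaf_order A b s).
Hypothesis nums : (\sum_(a <- A) circ_num A b a = p)%N.

Lemma circ_p_le : (p <= 2 ^ m)%N.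
Proof. exact: up_logP. Qed.

(** The multiplicities prescribed for b and for the points of [A] already add up to the length 2^m
    of [s]. *)
Lemma leaf_order_mem g : g \in s -> (g == b) || (g \in A).
Proof.
case: so => ss ca cb; suff /allP /(_ g) : all (predU (pred1 b) (mem A)) s by [].
rewrite all_count; apply/eqP.
have -> : count (predU (pred1 b) (mem A)) s = (count_mem b s + count (mem A) s)%N.
  rewrite -[LHS]addn0 -count_predUI; congr (_ + _)%N; apply/esym/eqP.
  rewrite -leqn0 leqNgt -has_count; apply/hasPn => x _ /=.
  by apply: contra bA => /andP[/eqP <-].
have -> : count (mem A) s = (\sum_(a <- A) count_mem a s)%N.
  elim: (s) => [|x t IH] /=; first by rewrite big1.
  rewrite big_split /= -IH; congr (_ + _)%N.
  have [xA|xA] := boolP (x \in A).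
    rewrite (bigD1_seq x xA (fset_uniq A)) /= eqxx big1 // => a /negbTE ax.
    by rewrite eq_sym ax.
  by rewrite big_seq big1 // => a aA; case: eqP => // xa; rewrite xa aA in xA.
rewrite cb big_seq (eq_bigr _ ca) -big_seq nums subnK ?ss //.
exact: circ_p_le.
Qed.

Lemma prod_leaf top :
  \prod_(j < 2 ^ m) leaf v b top s j.+1 =
  top ^+ (2 ^ m - p) * \prod_(a <- A) v a ^+ circ_num A b a.
Proof.
case: (so) => ss ca cb.
pose F g := if g == b then top else v g.
have -> : \prod_(j < 2 ^ m) leaf v b top s j.+1 = \prod_(g <- s) F g.
  by rewrite (big_nth b) big_mkord ss.
have gen (t : seq 'rV[R]_n) : (forall g, g \in t -> (g == b) || (g \in A)) ->
    \prod_(g <- t) F g = top ^+ count_mem b t * \prod_(a <- A) v a ^+ count_mem a t.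
  elim: t => [|x t IH] tA.
    by rewrite big_nil expr0 mul1r big1.
  rewrite big_cons IH => [|g gt]; last by apply: tA; rewrite inE gt orbT.
  have := tA x; rewrite inE eqxx => /(_ isT).
  rewrite /F /=; have [->|xb] /= := eqVneq x b.
    rewrite exprS -mulrA => _; congr (_ * (_ * _)).
    rewrite big_seq [RHS]big_seq; apply: eq_bigr => a aA.
    by case: eqP => // ba; move: bA; rewrite ba aA.
  rewrite add0n => xA; rewrite mulrCA; congr (_ * _).
  rewrite (bigD1_seq x xA (fset_uniq A)) /= [RHS](bigD1_seq x xA (fset_uniq A)) /=.
  rewrite eqxx add1n exprS -mulrA.
  congr (_ * (_ * _)); apply: eq_bigr => a /negbTE ax.
  by rewrite eq_sym ax.
rewrite gen; last exact: leaf_order_mem.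
rewrite cb; congr (_ * _); rewrite big_seq [RHS]big_seq.
by apply: eq_bigr => a aA; rewrite ca.
Qed.

(** The tree gives top^(2^m) <= top^(2^m - p) times the product over [A]; the padding factor is
    cancelled. *)
Lemma tree_psd_pow_le top y : (forall a, a \in A -> 0 <= v a) -> 0 <= top ->
  tree_psd (tree v A b top s y) m ->
  top ^+ p <= \prod_(a <- A) v a ^+ circ_num A b a.
Proof.
move=> v0 top0 tp; have pm := circ_p_le.
have := tree_psd_le_prod tp (leqnn m) (i := 1).
rewrite subnn expn0 /= => /(_ isT).
have -> : tree v A b top s y m 1 = top by rewrite /tree eqxx.
rewrite top0 orbT => /(_ isT); rewrite mul0n.
under eq_bigr => j _ do rewrite add0n {1}/tree eq_sym gtn_eqF //=.
rewrite prod_leaf -{1}(subnK pm) exprD.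
(* Nothing can be cancelled when [top] is 0, and 0^p = 0 needs p > 0; p = 0 would give m = 0, since
   [up_log] is 0 there. *)
have [->|tn] := eqVneq top 0.
  have [pE|p0] := posnP p; last first.
    by rewrite (expr0n _ p) gtn_eqF // big_seq prodr_ge0 // => a aA; rewrite exprn_ge0 ?v0.
  by move: m0; rewrite /circ_m pE up_log0.
by rewrite ler_pM2l // exprn_gt0 // lt_neqAle eq_sym tn.
Qed.

Lemma tree_psd_exists top : (forall a, a \in A -> 0 <= v a) -> 0 <= top ->
  top ^+ p <= \prod_(a <- A) v a ^+ circ_num A b a ->
  tree_psd (tree v A b top s (sqrt_tree (leaf v b top s))) m.
Proof.
move=> v0 top0 le; have pm := circ_p_le.
apply: (sqrt_tree_psd (L := leaf v b top s)) => // [i|].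
  rewrite /leaf; case: eqP => // gb.
  (* Past the end of [s] the default label is b, whose value is [top], so that leaves are
     non-negative at every index. *)
  have [im|im] := ltnP i.-1 (size s); last by rewrite nth_default in gb *.
  apply: v0; have := leaf_order_mem (mem_nth b im).
  by case/predU1P.
by rewrite prod_leaf -{1}(subnK pm) exprD ler_wpM2l // exprn_ge0.
Qed.

End CircuitBlocks.

(** * Reduced circuits *)

Section Weights.
Context (R : realType) (n : nat).
Local Notation V := 'rV[R]_n.
Implicit Types (A : {fset V}) (w t : V -> R) (x y : V).

Definition convex_weights A x w :=
  [/\ forall a, a \in A -> 0 <= w a, \sum_(a <- A) w a = 1
    & \sum_(a <- A) w a *: a = x].

(** Collects a combination of a family, possibly with repetitions, into weights attached to the
    points themselves. *)
Lemma sum_fibers (W : lmodType R) A (k : nat) (p : 'I_k -> V) (t : 'I_k -> R)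
    (F : V -> W) : (forall i, p i \in A) ->
  \sum_(a <- A) (\sum_(i < k | p i == a) t i) *: F a = \sum_(i < k) t i *: F (p i).
Proof.
move=> pA; under eq_bigr do rewrite scaler_suml big_mkcond /=.
rewrite exchange_big /=; apply: eq_bigr => i _.
rewrite (bigD1_seq (p i) (pA i) (fset_uniq A)) /= eqxx big1 ?addr0 // => a.
by rewrite eq_sym => /negbTE ->.
Qed.

Lemma sum_fibers1 A (k : nat) (p : 'I_k -> V) (t : 'I_k -> R) :
  (forall i, p i \in A) ->
  \sum_(a <- A) \sum_(i < k | p i == a) t i = \sum_(i < k) t i.
Proof.
move=> pA; have := @sum_fibers R^o A k p t (fun=> 1) pA.
by under eq_bigr do rewrite [_ *: _]mulr1; under [RHS]eq_bigr do rewrite [_ *: _]mulr1.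
Qed.

Lemma sum_fset_ord (W : nmodType) A (F : V -> W) :
  \sum_(i < size A) F (tnth (in_tuple A) i) = \sum_(a <- A) F a.
Proof. by rewrite [RHS]big_tnth. Qed.

Lemma convex_hullP A x :
  convex_hull [set` A] x <-> exists w, convex_weights A x w.
Proof.
split=> [[k [p [t [pA t0 t1 ->]]]]|[w [w0 w1 <-]]].
  exists (fun a => \sum_(i < k | p i == a) t i); split.
  - by move=> a _; rewrite sumr_ge0.
  - by rewrite sum_fibers1.
  - by rewrite sum_fibers.
exists (size A), (tnth (in_tuple A)), (fun i => w (tnth (in_tuple A) i)); split.
- by move=> i /=; apply: (mem_tnth i (in_tuple A)).
- by move=> i; apply: w0; apply: (mem_tnth i (in_tuple A)).
- by rewrite (sum_fset_ord _ w).
- by rewrite (sum_fset_ord _ (fun a => w a *: a)).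
Qed.

Lemma affine_hull_weights A y : affine_hull (convex_hull [set` A]) y ->
  exists w, \sum_(a <- A) w a = 1 /\ \sum_(a <- A) w a *: a = y.
Proof.
move=> [k [p [t [pA t1 ->]]]].
have /choice[W HW] i : exists w, convex_weights A (p i) w by exact/convex_hullP.
exists (fun a => \sum_(i < k) t i * W i a); split.
  rewrite exchange_big /= -[RHS]t1; apply: eq_bigr => i _.
  by have [_ w1 _] := HW i; rewrite -mulr_sumr w1 mulr1.
under eq_bigr do rewrite scaler_suml.
rewrite exchange_big /=; apply: eq_bigr => i _.
have [_ _ w1] := HW i; rewrite -w1 scaler_sumr.
by apply: eq_bigr => a _; rewrite scalerA.
Qed.

Lemma affinely_independent_uniq A w t : affinely_independent A ->
  \sum_(a <- A) w a = \sum_(a <- A) t a ->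
  \sum_(a <- A) w a *: a = \sum_(a <- A) t a *: a ->
  forall a, a \in A -> w a = t a.
Proof.
move=> Ai e1 e2 a aA; apply/eqP; rewrite -subr_eq0; apply/eqP.
apply: (Ai (fun a => w a - t a)) => //; first by rewrite sumrB e1 subrr.
by under eq_bigr do rewrite scalerBl; rewrite sumrB e2 subrr.
Qed.

Lemma mem_convex_hull A a : a \in A -> convex_hull [set` A] a.
Proof.
move=> aA; apply/convex_hullP; exists (fun x => (x == a)%:R); split.
- by move=> x _; rewrite ler0n.
- rewrite (bigD1_seq a aA (fset_uniq A)) /= eqxx big1 ?addr0 // => x /negbTE ->.
  by [].
- rewrite (bigD1_seq a aA (fset_uniq A)) /= eqxx scale1r big1 ?addr0 // => x /negbTE ->.
  by rewrite scale0r.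
Qed.

Definition rational_points A :=
  forall a, a \in A -> forall j, @rational R (a 0 j).

(* Over the rationals Farkas' lemma yields either the coordinate function or
   an affine dependence of A. *)
Lemma affine_coordinate A a0 : affinely_independent A -> rational_points A ->
  a0 \in A -> exists (h : 'I_n -> rat) (c : rat), forall a, a \in A ->
    \sum_j a 0 j * ratr (h j) + ratr c = (a == a0)%:R.
Proof.
move=> Ai AQ aA0.
have /choice[q Hq] a : exists q : 'I_n -> rat, a \in A -> forall j, ratr (q j) = a 0 j.
  have [aA|_] := boolP (a \in A); last by exists (fun=> 0).
  have /choice[q Hq] j : exists r : rat, ratr r = a 0 j.
    by have [r _ <-] := AQ a aA j; exists r.
  by exists q.
pose S := [seq (a, e) | a <- enum_fset A, e <- [:: true; false]].
have uS : uniq S by rewrite allpairs_uniq ?fset_uniq // => -[? ?] [? ?].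
(* Each equation is encoded as two opposite inequalities, distinguished by the boolean; the
   additional last coordinate carries the constant term c. *)
pose u (ae : V * bool) : 'rV[rat]_(n + 1) :=
  (-1) ^+ ae.2 *: row_mx (\row_j q ae.1 j) 1.
have ul a e j : u (a, e) 0 (lshift 1 j) = (-1) ^+ e * q a j.
  by rewrite mxE row_mxEl mxE.
have ur a e : u (a, e) 0 (rshift n ord0) = (-1) ^+ e.
  by rewrite mxE row_mxEr mxE mulr1.
pose g (ae : V * bool) : rat := (-1) ^+ ae.2 * (ae.1 == a0)%:R.
have sumS (W : zmodType) (F : V * bool -> W) :
    \sum_(ae <- S) F ae = \sum_(a <- A) (F (a, true) + F (a, false)).
  rewrite big_allpairs; apply: eq_bigr => a _.
  by rewrite !big_cons big_nil /= addr0.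
have [[y Hy]|[w [w0 wu wg]]] := farkas u g uS.
  exists (fun j => y (lshift 1 j)), (y (rshift n ord0)) => a aA.
  have yE e : \sum_j u (a, e) 0 j * y j = (-1) ^+ e *
      (\sum_j q a j * y (lshift 1 j) + y (rshift n ord0)).
    rewrite big_split_ord /= big_ord1 mulrDr mulr_sumr; congr (_ + _).
      by apply: eq_bigr => j _; rewrite ul mulrA.
    by rewrite ur.
  have yE' : \sum_j q a j * y (lshift 1 j) + y (rshift n ord0) = (a == a0)%:R.
    have aS e : (a, e) \in S.
      by apply/allpairsP; exists (a, e); split=> //; case: e.
    have := Hy _ (aS true); have := Hy _ (aS false); rewrite !yE /g /=.
    by rewrite expr0 expr1 !mul1r !mulN1r lerN2 => h1 h2; apply/le_anti/andP.
  transitivity (ratr (a == a0)%:R : R); last by rewrite ratr_nat.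
  rewrite -yE' rmorphD rmorph_sum /=; congr (_ + _); apply: eq_bigr => j _.
  by rewrite rmorphM /= Hq.
(* The multipliers of the two opposite inequalities combine into an affine dependence, which must
   vanish at [a0]; this contradicts [wg], whose left-hand side is [d a0]. *)
pose d a := w (a, false) - w (a, true).
have wE a k : (w (a, true) *: u (a, true) + w (a, false) *: u (a, false)) 0 k =
    w (a, true) * u (a, true) 0 k + w (a, false) * u (a, false) 0 k.
  by rewrite [LHS]mxE; congr (_ + _); rewrite [LHS]mxE.
have d1 : \sum_(a <- A) d a = 0.
  have /(congr1 (fun M : 'rV_(n + 1) => M 0 (rshift n ord0))) := wu.
  rewrite sumS summxE mxE => e; rewrite -[RHS]e; apply: eq_bigr => a _.
  by rewrite wE !ur expr0 expr1 /d; ring.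
have d2 j : \sum_(a <- A) d a * q a j = 0.
  have /(congr1 (fun M : 'rV_(n + 1) => M 0 (lshift 1 j))) := wu.
  rewrite sumS summxE mxE => e; rewrite -[RHS]e; apply: eq_bigr => a _.
  by rewrite wE !ul expr0 expr1 /d; ring.
have : ratr (d a0) = 0 :> R.
  apply: (Ai (fun a => ratr (d a))) => //.
    by rewrite -(rmorph_sum (@ratr R)) d1 rmorph0.
  apply/rowP => j; rewrite summxE mxE.
  transitivity (ratr (\sum_(a <- A) d a * q a j) : R); last by rewrite d2 rmorph0.
  rewrite rmorph_sum big_seq [RHS]big_seq; apply: eq_bigr => a aA.
  by rewrite !mxE rmorphM /= Hq.
move/eqP; rewrite fmorph_eq0 => /eqP d0.
move: wg; rewrite sumS (bigD1_seq a0 aA0 (fset_uniq A)) /= big1.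
  rewrite /g /= expr0 expr1 eqxx addr0 /= !mul1r !mulr1; move: d0; rewrite /d; lra.
by move=> a /negbTE aa0; rewrite /g /= aa0 !mulr0 addr0.
Qed.

(** A barycentric coordinate is an affine function of the point with rational coefficients. This
    yields both its continuity and its rationality at rational points. *)
Lemma affine_coordinateE A a0 : affinely_independent A -> rational_points A ->
  a0 \in A -> exists (h : 'I_n -> rat) (c : rat), forall w,
    \sum_(a <- A) w a = 1 ->
    w a0 = \sum_j (\sum_(a <- A) w a *: a) 0 j * ratr (h j) + ratr c.
Proof.
move=> Ai AQ aA0; have [h [c hc]] := affine_coordinate Ai AQ aA0.
exists h, c => w w1.
transitivity (\sum_(a <- A) w a * (a == a0)%:R).
  rewrite (bigD1_seq a0 aA0 (fset_uniq A)) /= eqxx mulr1 big1 ?addr0 // => a.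
  by move=> /negbTE ->; rewrite mulr0.
transitivity (\sum_(a <- A) w a * (\sum_j a 0 j * ratr (h j) + ratr c)).
  by rewrite big_seq [RHS]big_seq; apply: eq_bigr => a aA; rewrite hc.
under eq_bigr do rewrite mulrDr mulr_sumr.
rewrite big_split /= -mulr_suml w1 mul1r exchange_big; congr (_ + _).
apply: eq_bigr => j _; rewrite summxE mulr_suml; apply: eq_bigr => a _.
by rewrite mxE mulrA.
Qed.

Lemma near_rVP x (P : V -> Prop) : (\forall y \near x, P y) <->
  exists2 e : R, 0 < e & forall y, (forall j, `|x 0 j - y 0 j| < e) -> P y.
Proof.
split=> [/nbhs_ballP[e e0 eP]|[e e0 eP]].
  exists e => // y xy; apply: eP; split=> // i j.
  by rewrite ord1; apply: xy.
apply/nbhs_ballP; exists e => // y [_ xy].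
by apply: eP => j; apply: xy.
Qed.

Lemma near_seq (P : V -> V -> Prop) (s : seq V) x :
  (forall a, a \in s -> \forall y \near x, P a y) ->
  \forall y \near x, forall a, a \in s -> P a y.
Proof.
elim: s => [|a s IH] Ps; first by near=> y.
have {}IH : \forall y \near x, forall a, a \in s -> P a y.
  by apply: IH => a' sa'; apply: Ps; rewrite inE sa' orbT.
have Pa : \forall y \near x, P a y by apply: Ps; rewrite mem_head.
near=> y => a'; rewrite inE => /predU1P[->|]; first by near: y.
by move: a'; near: y.
Unshelve. all: by end_near.
Qed.

(** The coordinates are continuous on the affine hull, so those that are positive at x remain
    positive nearby. *)
Lemma barycentric_relint A x w : affinely_independent A -> rational_points A ->
  barycentric A x w -> relint (convex_hull [set` A]) x.
Proof.
move=> Ai AQ [w0 wx w1]; split.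
  by apply/convex_hullP; exists w; split=> // a /w0 /ltW.
have coord a : a \in A -> \forall y \near x, forall t : V -> R,
    \sum_(a <- A) t a = 1 -> \sum_(a <- A) t a *: a = y -> 0 < t a.
  move=> aA; have [h [c hc]] := affine_coordinateE Ai AQ aA.
  pose F (y : V) : R := \sum_j y 0 j * ratr (h j) + ratr c.
  have F0 : 0 < F x by rewrite /F -wx -hc //; exact: w0.
  (* A Lipschitz constant of [F] for the maximum norm; the added 1 makes it positive. *)
  pose H : R := 1 + \sum_j `|ratr (h j)|.
  have H0 : 0 < H by rewrite ltr_wpDr ?sumr_ge0.
  apply/near_rVP; exists (F x / H) => [|y xy t t1 ty]; first exact: divr_gt0.
  rewrite (hc t t1) ty -/(F y) -[F y](subKr (F x)) subr_gt0.
  have -> : F x - F y = \sum_j (x 0 j - y 0 j) * ratr (h j).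
    rewrite /F opprD addrACA subrr addr0 -sumrB.
    by apply: eq_bigr => j _; rewrite mulrBl.
  apply: le_lt_trans (_ : F x / H * (\sum_j `|ratr (h j)|) < _).
    rewrite mulr_sumr; apply: ler_sum => j _.
    by apply: le_trans (ler_norm _) _; rewrite normrM ler_wpM2r // ltW.
  by rewrite mulrAC ltr_pdivrMr // ltr_pM2l // ltrDr.
have /(@near_seq _ (enum_fset A)) := coord.
apply: filterS => y Hy /affine_hull_weights[t [t1 ty]].
by apply/convex_hullP; exists t; split=> // a aA; apply/ltW/(Hy a).
Qed.

(** If the weight of x at [a0] were 0, moving from x slightly away from [a0] would stay in the
    affine hull but make that weight negative, hence leave the convex hull. *)
Lemma relint_barycentric A x : affinely_independent A ->
  relint (convex_hull [set` A]) x -> exists w, barycentric A x w.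
Proof.
move=> Ai [/convex_hullP[w [w0 w1 wx]] xn].
exists w; split=> // a0 aA0; rewrite lt_neqAle w0 // andbT eq_sym.
apply/eqP => wa0.
pose f (e : R) := x + e *: (x - a0).
have fa e : affine_hull (convex_hull [set` A]) (f e).
  exists 2%N, (fun i => if i == 0 then x else a0), (fun i => if i == 0 then 1 + e else - e).
  split=> [i||].
  - case: ifP => _; last exact: mem_convex_hull.
    by apply/convex_hullP; exists w.
  - by rewrite big_ord_recl big_ord1 /=; ring.
  - rewrite big_ord_recl big_ord1 /= /f scalerDl scale1r scalerBr scaleNr addrA.
    by [].
have [e [e0 /(_ (fa e)) /convex_hullP[t [t0 t1 tx]]]] :
    exists e, 0 < e /\ (affine_hull (convex_hull [set` A]) (f e) ->
                        convex_hull [set` A] (f e)).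
  have /near_rVP[d d0 dP] := xn.
  pose H : R := 1 + \sum_j `|x 0 j - a0 0 j|.
  have H0 : 0 < H by rewrite ltr_wpDr ?sumr_ge0.
  exists (d / H); split=> [|]; first exact: divr_gt0.
  apply: dP => j; rewrite /f !mxE opprD addNKr normrN normrM.
  rewrite gtr0_norm ?divr_gt0 // mulrAC ltr_pdivrMr // ltr_pM2l //.
  rewrite /H (bigD1 j) //= addrCA ltrDl ltr_wpDr ?sumr_ge0 //.
have : t a0 = (1 + e) * w a0 - e * (a0 == a0)%:R.
  apply: (@affinely_independent_uniq A t (fun a => (1 + e) * w a - e * (a == a0)%:R)) => //.
    rewrite t1 sumrB -!mulr_sumr w1 (bigD1_seq a0 aA0 (fset_uniq A)) /= eqxx.
    by rewrite big1 => [|a /negbTE -> //]; rewrite /= addr0; ring.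
  rewrite tx; under eq_bigr do rewrite scalerBl -!scalerA.
  rewrite sumrB -!scaler_sumr wx (bigD1_seq a0 aA0 (fset_uniq A)) /= eqxx big1.
    by rewrite addr0 scale1r /f scalerBr scalerDl scale1r addrA.
  by move=> a /negbTE ->; rewrite scale0r.
by move=> ta; have := t0 _ aA0; rewrite ta wa0 eqxx /= mulr0 mulr1; lra.
Qed.

End Weights.

Lemma seq_argmin (R : realDomainType) (T : eqType) (s : seq T) (F : T -> R) x0 :
  x0 \in s -> exists2 x, x \in s & forall y, y \in s -> F x <= F y.
Proof.
elim: s x0 => // x s IH x0 _.
case: s IH => [|z s] IH.
  by exists x; rewrite ?mem_head // => y; rewrite inE => /eqP ->.
have [x' x's x'P] := IH z (mem_head _ _).
have [xx'|/ltW x'x] := leP (F x) (F x').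
  exists x; rewrite ?mem_head // => y.
  by rewrite inE => /predU1P[->//|/x'P]; apply: le_trans.
exists x'; first by rewrite inE x's orbT.
by move=> y; rewrite inE => /predU1P[->//|/x'P].
Qed.

(** * From reduced circuits to all convex combinations *)

Section Reduction.
Context (R : realType) (n : nat).
Local Notation V := 'rV[R]_n.
Implicit Types (A : {fset V}) (w t : V -> R) (x y : V).

(** The ratio test of the simplex method: s is the smallest quotient w_a / t_a over the points with
    t_a > 0, and [a0] attains it. *)
Lemma max_step A w t a1 : (forall a, a \in A -> 0 <= w a) ->
  a1 \in A -> 0 < t a1 ->
  exists2 s, 0 <= s & exists a0, [/\ a0 \in A, 0 < t a0, w a0 - s * t a0 = 0 &
    forall a, a \in A -> 0 <= w a - s * t a].
Proof.
move=> w0 a1A ta1.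
have : a1 \in [seq a <- enum_fset A | 0 < t a] by rewrite mem_filter ta1.
move=> /(seq_argmin (fun a => w a / t a))[a0].
rewrite mem_filter => /andP[ta0 a0A] min.
have s0 : 0 <= w a0 / t a0 by rewrite divr_ge0 ?w0 // ltW.
exists (w a0 / t a0) => //; exists a0; split=> // [|a aA].
  by rewrite divfK ?subrr // gt_eqF.
have [ta|ta] := ltP 0 (t a).
  by rewrite subr_ge0 -ler_pdivlMr // min // mem_filter ta.
by rewrite subr_ge0 (le_trans _ (w0 a aA)) // mulr_ge0_le0.
Qed.

Lemma sum_fsetD1_0 (W : lmodType R) A (c : V -> R) a0 (F : V -> W) : a0 \in A -> c a0 = 0 ->
  \sum_(a <- (A `\ a0)%fset) c a *: F a = \sum_(a <- A) c a *: F a.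
Proof. by move=> aA c0; rewrite [RHS](big_fsetD1 a0) //= c0 scale0r add0r. Qed.

Lemma sum_fset_swap (W : lmodType R) A (c : V -> R) a0 y (s : R) (F : V -> W) :
  a0 \in A -> y \notin A -> c a0 = 0 ->
  \sum_(a <- (y |` (A `\ a0))%fset) (if a == y then s else c a) *: F a =
  s *: F y + \sum_(a <- A) c a *: F a.
Proof.
move=> aA yA c0; rewrite big_fsetU1 /=; last by rewrite !inE negb_and yA orbT.
rewrite eqxx -(sum_fsetD1_0 _ aA c0); congr (_ + _).
rewrite big_seq [RHS]big_seq; apply: eq_bigr => a.
by rewrite !inE => /andP[_ aA']; case: eqP => // ay; move: yA; rewrite -ay aA'.
Qed.

Lemma convex_weightsD1 A x w a0 : convex_weights A x w -> a0 \in A -> w a0 = 0 ->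
  convex_weights (A `\ a0)%fset x w.
Proof.
move=> [w0 w1 wx] a0A wa0; split.
- by move=> a; rewrite !inE => /andP[_ /w0].
- by have := @sum_fsetD1_0 R^o A w a0 (fun=> 1) a0A wa0;
     under eq_bigr do rewrite [_ *: _]mulr1;
     under [X in _ = X -> _]eq_bigr do rewrite [_ *: _]mulr1; rewrite w1.
- by rewrite (sum_fsetD1_0 id).
Qed.

Lemma convex_hull_sub A A' : (forall a, a \in A -> convex_hull [set` A'] a) ->
  convex_hull [set` A] `<=` convex_hull [set` A'].
Proof.
move=> AA' x /convex_hullP[w [w0 w1 wx]].
have /choice[W HW] a : exists u, a \in A -> convex_weights A' a u.
  have [/AA'/convex_hullP[u]|_] := boolP (a \in A); last by exists (fun=> 0).
  by exists u.
apply/convex_hullP; exists (fun a' => \sum_(a <- A) w a * W a a'); split.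
- move=> a' a'A; rewrite big_seq sumr_ge0 // => a aA.
  by have [W0 _ _] := HW a aA; rewrite mulr_ge0 ?w0 ?W0.
- rewrite exchange_big /= -[RHS]w1 big_seq [RHS]big_seq; apply: eq_bigr => a aA.
  by have [_ W1 _] := HW a aA; rewrite -mulr_sumr W1 mulr1.
- under eq_bigr do rewrite scaler_suml.
  rewrite exchange_big /= -[RHS]wx big_seq [RHS]big_seq; apply: eq_bigr => a aA.
  have [_ _ W1] := HW a aA.
  transitivity (w a *: \sum_(a' <- A') W a a' *: a'); last by rewrite W1.
  by rewrite scaler_sumr; apply: eq_bigr => a' _; rewrite scalerA.
Qed.

Context (AA C : {fset V}) (f : V -> R).
Hypotheses (AAC : (AA `<=` C)%fset) (AAQ : rational_points AA).

Definition hull_points A : {fset V} := [fset a in AA | `[< convex_hull [set` A] a >]]%fset.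

Lemma hull_pointsP A a :
  a \in hull_points A <-> a \in AA /\ convex_hull [set` A] a.
Proof.
rewrite !inE /=; split=> [/andP[-> /asboolP]//|[-> h]].
exact/asboolP.
Qed.

Lemma hull_points_sub A A' : (forall a, a \in A -> convex_hull [set` A'] a) ->
  (hull_points A `<=` hull_points A')%fset.
Proof.
move=> AA'; apply/fsubsetP => x /hull_pointsP[xA xh]; apply/hull_pointsP; split=> //.
exact: (convex_hull_sub AA').
Qed.

Hypothesis circuit_le : forall A b w, reduced_circuit AA C A b ->
  barycentric A b w -> f b <= \sum_(a <- A) w a * f a.

Definition hull_le A := forall x w, x \in C -> convex_weights A x w ->
  f x <= \sum_(a <- A) w a * f a.

Lemma sum_scale (A : {fset V}) (w g : V -> R) :
  \sum_(a <- A) w a * g a = \sum_(a <- A) w a *: (g a : R^o).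
Proof. by []. Qed.

(** The step of Caratheodory's theorem: the weights move along an affine dependence until one of
    them vanishes, in the direction that does not increase the right-hand side. *)
Lemma hull_le_dependent A : ~ affinely_independent A ->
  (forall a, a \in A -> hull_le (A `\ a)%fset) -> hull_le A.
Proof.
move=> Ad IH x w xC cw.
have [t [t1 tx [a1 a1A ta1]]] : exists t, [/\ \sum_(a <- A) t a = 0,
    \sum_(a <- A) t a *: a = 0 & exists2 a, a \in A & t a != 0].
  apply: contrapT => H; apply: Ad => t t1 tx a aA.
  by apply/eqP; apply: contrapT => /negP ta; apply: H; exists t; split=> //; exists a.
(* Replacing t by -t fixes the direction; subtracting a non-negative multiple of t then cannot raise
   the interpolated value of f. *)
wlog tf : t t1 tx ta1 / 0 <= \sum_(a <- A) t a * f a.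
  have [tf /(_ t)|tf /(_ (fun a => - t a))] := leP 0 (\sum_(a <- A) t a * f a).
    by apply.
  apply; rewrite ?oppr_eq0 //.
  - by rewrite sumrN t1 oppr0.
  - by under eq_bigr do rewrite scaleNr; rewrite sumrN tx oppr0.
  - by under eq_bigr do rewrite mulNr; rewrite sumrN oppr_ge0 ltW.
have [a2 a2A ta2] : exists2 a, a \in A & 0 < t a.
  apply: contrapT => H.
  have tneg a : a \in A -> t a <= 0.
    by move=> aA; rewrite leNgt; apply/negP => ta; apply: H; exists a.
  move/eqP: t1; rewrite -oppr_eq0 -sumrN (big_fsetD1 a1) //= paddr_eq0 ?oppr_ge0 ?tneg //.
    by rewrite oppr_eq0 (negbTE ta1).
  by rewrite big_seq sumr_ge0 // => a; rewrite !inE oppr_ge0 => /andP[_ /tneg].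
have [w0 w1 wx] := cw.
have [s s0 [a0 [a0A _ wa0 w'0]]] := max_step w0 a2A ta2.
have cw' : convex_weights A x (fun a => w a - s * t a).
  split=> //; first by rewrite sumrB -mulr_sumr t1 mulr0 subr0.
  under eq_bigr do rewrite scalerBl -scalerA.
  by rewrite sumrB -scaler_sumr tx scaler0 subr0.
apply: le_trans (IH a0 a0A x _ xC (convex_weightsD1 cw' a0A wa0)) _.
rewrite sum_scale sum_fsetD1_0 // -sum_scale.
under eq_bigr do rewrite mulrBl -mulrA.
by rewrite sumrB -mulr_sumr gerBl mulr_ge0.
Qed.

(* Among the points of C in the hull of A, consider one at which f exceeds
   the affine interpolation of f on A the most.  Unless it forms a reduced
   circuit with A, some vertex of A can be exchanged for a point of AA inside
   the hull, at which the excess is not larger. *)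
Lemma hull_le_independent A : (A `<=` AA)%fset -> affinely_independent A ->
  (forall a, a \in A -> hull_le (A `\ a)%fset) ->
  (forall a y, a \in A -> y \in AA -> y \notin A -> convex_hull [set` A] y ->
     (hull_points (y |` (A `\ a))%fset `<` hull_points A)%fset ->
     hull_le (y |` (A `\ a))%fset) ->
  hull_le A.
Proof.
move=> AAA Ai IH1 IH2.
have AQ : rational_points A by move=> a aA; apply: AAQ; apply: (fsubsetP AAA).
have /choice[W HW] x : exists w, convex_hull [set` A] x -> convex_weights A x w.
  have [/convex_hullP[w cw]|] := pselect (convex_hull [set` A] x); first by exists w.
  by exists (fun=> 0).
have uniqW x w : convex_weights A x w -> forall a, a \in A -> w a = W x a.
  move=> cw; have hx : convex_hull [set` A] x by apply/convex_hullP; exists w.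
  have [[_ w1 wx] [_ W1 Wx]] := (cw, HW x hx).
  by apply: affinely_independent_uniq; rewrite // ?W1 ?Wx.
pose gap x := f x - \sum_(a <- A) W x a * f a.
have gapE x w : convex_weights A x w -> gap x = f x - \sum_(a <- A) w a * f a.
  move=> /uniqW wW; rewrite /gap; congr (_ - _).
  by rewrite big_seq [RHS]big_seq; apply: eq_bigr => a /wW ->.
pose G := [seq x <- enum_fset C | `[< convex_hull [set` A] x >]].
have GP x : x \in C -> convex_hull [set` A] x -> x \in G.
  by move=> xC xh; rewrite mem_filter; apply/andP; split; first exact/asboolP.
suff gap0 x : x \in G -> gap x <= 0.
  move=> x w xC cw; rewrite -subr_le0 -(gapE _ _ cw); apply/gap0/GP => //.
  by apply/convex_hullP; exists w.
move=> xG; have [z zG zmax] := seq_argmin (fun x => - gap x) xG.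
have := zmax x xG; rewrite lerN2 => /le_trans; apply.
have [zC zh] : z \in C /\ convex_hull [set` A] z.
  by move: zG; rewrite mem_filter => /andP[/asboolP].
have cw := HW z zh; have [w0 w1 wz] := cw.
rewrite leNgt; apply/negP => gz.
(* A zero weight would put z in the hull of a proper face, where [IH1] already gives a gap of at
   most 0. *)
have wp a : a \in A -> 0 < W z a.
  move=> aA; rewrite lt_neqAle w0 // andbT eq_sym; apply/eqP => wa0.
  have := IH1 a aA z (W z) zC (convex_weightsD1 cw aA wa0).
  by rewrite sum_scale sum_fsetD1_0 // -sum_scale -subr_le0 leNgt -/(gap z) gz.
have delta a : a \in A -> convex_weights A a (fun x => (x == a)%:R).
  move=> aA; split=> [a' _||]; first by rewrite ler0n.
    rewrite (big_fsetD1 a) //= eqxx big_seq big1 ?addr0 // => a'.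
    by rewrite !inE => /andP[/negbTE ->].
  rewrite (big_fsetD1 a) //= eqxx scale1r big_seq big1 ?addr0 // => a'.
  by rewrite !inE => /andP[/negbTE ->]; rewrite scale0r.
have zA : z \notin A.
  apply/negP => zA; move: gz; rewrite (gapE _ _ (delta z zA)).
  rewrite (big_fsetD1 z) //= eqxx mul1r big_seq big1 ?addr0 ?subrr ?ltxx // => a'.
  by rewrite !inE => /andP[/negbTE ->]; rewrite mul0r.
have [[y [yAA yh yA yz]]|none] :=
    pselect (exists y, [/\ y \in AA, convex_hull [set` A] y, y \notin A & y <> z]); last first.
  have bz : barycentric A z (W z) by [].
  suff /circuit_le /(_ bz) : reduced_circuit AA C A z.
    by rewrite -subr_le0 leNgt -/(gap z) gz.
  split=> //; first exact: barycentric_relint bz.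
    by rewrite !inE zA.
  rewrite -subset0 => y [[/= yAA yh] yn]; apply: none; exists y; split=> //.
    by apply/negP => yA; apply: yn; left.
  by move=> yz; apply: yn; right.
have [u0 u1 uy] := HW y yh.
have [a1 a1A ua1] : exists2 a, a \in A & 0 < W y a.
  apply: contrapT => H; have : \sum_(a <- A) W y a <= 0.
    rewrite big_seq sumr_le0 // => a aA; rewrite leNgt; apply/negP => ua.
    by apply: H; exists a.
  by rewrite u1 ler10.
have [s s0 [a0 [a0A ua0 wa0 w'0]]] := max_step w0 a1A ua1.
(* Thus z is s times y plus the combination with weights [w'], which omits [a0]. *)
set w' := (fun a => W z a - s * W y a) in wa0 w'0.
have w'1 : \sum_(a <- A) w' a = 1 - s by rewrite sumrB -mulr_sumr u1 mulr1 w1.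
have w'z : \sum_(a <- A) w' a *: a = z - s *: y.
  under eq_bigr do rewrite scalerBl -scalerA.
  by rewrite sumrB -scaler_sumr uy wz.
(* The weights [w'] are non-negative with sum 1 - s; if this sum were 0, z would be y. *)
have s1 : s < 1.
  rewrite -subr_gt0 lt_neqAle -w'1 {2}big_seq sumr_ge0 ?andbT //.
  apply/eqP => /esym; rewrite big_seq => /eqP; rewrite psumr_eq0 // => /allP w'e.
  apply: yz; have e0 : z - s *: y = 0.
    rewrite -w'z big_seq big1 // => a aA.
    by have := w'e a aA; rewrite aA => /eqP ->; rewrite scale0r.
  have : 1 - s = 0.
    rewrite -w'1 big_seq big1 // => a aA.
    by have := w'e a aA; rewrite aA => /eqP ->.
  by move/subr0_eq => s1; move/subr0_eq: e0; rewrite -s1 scale1r.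
have yA0 : y \notin (A `\ a0)%fset by rewrite !inE negb_and yA orbT.
have cw' : convex_weights (y |` (A `\ a0))%fset z (fun a => if a == y then s else w' a).
  split.
  - move=> a; rewrite !inE => /orP[/eqP ->|/andP[_ aA]]; first by rewrite eqxx.
    by case: ifP => // _; apply: w'0.
  - have := @sum_fset_swap R^o A w' a0 y s (fun=> 1) a0A yA wa0.
    rewrite -[RHS]/(s * 1 + \sum_(a <- A) w' a * 1).
    under eq_bigr do rewrite [_ *: _]mulr1.
    by under [X in _ = _ + X -> _]eq_bigr do rewrite mulr1; rewrite w'1 => ->; ring.
  - by rewrite (@sum_fset_swap V A w' a0 y s id) // w'z addrC subrK.
(* The vertex [a0] leaves the hull: were it a combination of y and the other vertices, comparing
   coordinates in [A] would concentrate y on [a0], forcing y = a0. *)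
have proper : (hull_points (y |` (A `\ a0))%fset `<` hull_points A)%fset.
  have hs a : a \in (y |` (A `\ a0))%fset -> convex_hull [set` A] a.
    by rewrite !inE => /orP[/eqP -> //|/andP[_ /mem_convex_hull]].
  rewrite fproperEneq hull_points_sub // andbT; apply/negP => /eqP eqh.
  have : a0 \in hull_points A.
    by apply/hull_pointsP; split; [exact: (fsubsetP AAA)|exact: mem_convex_hull].
  rewrite -eqh => /hull_pointsP[_ /convex_hullP[v [v0 v1 va0]]].
  pose c a := if a == a0 then 0 else v a.
  have ca0 : c a0 = 0 by rewrite /c eqxx.
  have vE (U : lmodType R) (F : V -> U) :
      \sum_(a <- (y |` (A `\ a0))%fset) v a *: F a = v y *: F y + \sum_(a <- A) c a *: F a.
    rewrite -(sum_fset_swap _ _ a0A yA ca0) big_seq [RHS]big_seq.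
    apply: eq_bigr => a; rewrite !inE /c => /orP[/eqP ->|/andP[/negbTE -> aA]].
      by rewrite eqxx.
    by case: eqP => // ->.
  have e : forall a, a \in A -> v y * W y a + c a = (a == a0)%:R.
    have [_ d1 da] := delta _ a0A.
    apply: (affinely_independent_uniq (w := fun a => v y * W y a + c a)
      (t := fun a => (a == a0)%:R) Ai); rewrite ?d1 ?da.
      rewrite big_split -mulr_sumr u1 -[RHS]v1 /=.
      have /= := vE R^o (fun=> 1); rewrite -[RHS]/(v y * 1 + \sum_(a <- A) c a * 1).
      under eq_bigr do rewrite [_ *: _]mulr1.
      by under [X in _ = _ + X -> _]eq_bigr do rewrite mulr1.
    under eq_bigr do rewrite scalerDl -scalerA.
    by rewrite big_split -scaler_sumr uy /= -va0 (vE V id).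
  have vy : v y * W y a0 = 1 by have := e a0 a0A; rewrite ca0 addr0 eqxx.
  have vy0 : 0 < v y.
    rewrite lt_neqAle v0 ?andbT; last by rewrite !inE eqxx.
    by apply/eqP => vy0; move/eqP: vy; rewrite -vy0 mul0r eq_sym oner_eq0.
  have ua a : a \in A -> a != a0 -> W y a = 0.
    move=> aA aa0; have := e a aA; rewrite (negbTE aa0) => /eqP.
    rewrite paddr_eq0 ?mulr_ge0 ?u0 ?(ltW vy0) //; last first.
      by rewrite /c (negbTE aa0) v0 // !inE aa0 aA orbT.
    by rewrite mulf_eq0 gt_eqF //= => /andP[/eqP].
  suff ya0 : y = a0 by rewrite ya0 a0A in yA.
  have u00 : W y a0 = 1.
    rewrite -u1 (big_fsetD1 a0) //= big_seq big1 ?addr0 // => a.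
    by rewrite !inE => /andP[aa0 aA]; rewrite ua.
  rewrite -uy (big_fsetD1 a0) //= u00 scale1r big_seq big1 ?addr0 // => a.
  by rewrite !inE => /andP[aa0 aA]; rewrite ua // scale0r.
have := IH2 a0 y a0A yAA yA yh proper z _ zC cw'.
rewrite sum_scale (@sum_fset_swap R^o A w' a0 y s f) // -sum_scale -[_ *: _]/(s * f y).
under eq_bigr do rewrite mulrBl -mulrA.
rewrite sumrB -mulr_sumr => fz.
(* The exchange gives gap z <= s gap y, and maximality bounds this by s gap z, which is less than
   gap z since s < 1 and the gap is positive. *)
have gy : gap y <= gap z.
  by have := zmax y (GP y (fsubsetP AAC y yAA) yh); rewrite lerN2.
have : gap z <= s * gap y by rewrite /gap; lra.
have : s * gap y <= s * gap z by rewrite ler_wpM2l.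
have : s * gap z < gap z by rewrite gtr_pMl.
lra.
Qed.

(** Induction on the number of vertices plus the number of points of [AA] in the hull: deleting a
    vertex lowers the first, an exchange keeps it and lowers the second. *)
Lemma reduced_circuits_hull_le A : (A `<=` AA)%fset -> hull_le A.
Proof.
have [k] := ubnP (#|` A| + #|` hull_points A|)%N.
elim: k A => // k IH A; rewrite ltnS => Ak AAA.
have IH1 a : a \in A -> hull_le (A `\ a)%fset.
  move=> aA; apply: IH; last exact: fsubset_trans (fsubD1set _ _) AAA.
  apply: leq_trans Ak; rewrite -addSn leq_add //.
    by rewrite [X in (_ <= X)%N](cardfsD1 a) aA.
  apply: fsubset_leq_card; apply: hull_points_sub => a'.
  by rewrite !inE => /andP[_ /mem_convex_hull].
have [Ai|] := pselect (affinely_independent A); last first.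
  by move=> Ad; exact: hull_le_dependent.
apply: hull_le_independent => // a y aA yAA yA yh yp.
apply: IH; last first.
  by rewrite fsubUset fsub1set yAA (fsubset_trans (fsubD1set _ _)).
apply: leq_trans Ak; rewrite -addnS leq_add //; last exact: fproper_ltn_card.
by rewrite cardfsU1 !inE negb_and yA orbT /= [X in (_ <= X)%N](cardfsD1 a) aA.
Qed.
End Reduction.

Lemma exists_common_multiple (R : realType) (T : eqType) (s : seq T) (l : T -> R) :
  (forall a, a \in s -> 0 <= l a /\ exists r : rat, l a = ratr r) ->
  exists p : nat, (0 < p)%N /\ forall a, a \in s -> p%:R * l a \is a Num.nat.
Proof.
elim: s => [|x s IH] Hs; first by exists 1%N.
have [|p [p0 Hp]] := IH; first by move=> a sa; apply: Hs; rewrite inE sa orbT.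
have [lx [r rx]] := Hs x (mem_head _ _).
have r0 : 0 <= r by rewrite rx ler0q in lx.
have dl : (`|denq r|%N)%:R * l x = (`|numq r|%N)%:R.
  have := congr1 (@ratr R) (numqE r).
  rewrite rmorphM /= !ratr_int -rx mulrC.
  by rewrite -[numq r]gez0_abs ?numq_ge0 // -[denq r]gez0_abs ?(ltW (denq_gt0 r)) //.
exists (`|denq r| * p)%N; rewrite muln_gt0 p0 absz_gt0 denq_neq0; split=> // a.
rewrite inE natrM => /predU1P[->|/Hp sa]; last by rewrite -mulrA rpredM ?natr_nat.
by rewrite mulrAC dl rpredM ?natr_nat.
Qed.

(** * Barycentric coordinates and common denominators of a circuit *)

Section CircuitNumbers.
Context (R : realType) (n : nat) (A : {fset 'rV[R]_n}) (b : 'rV[R]_n).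
Hypotheses (Ai : affinely_independent A) (AQ : rational_points A).
Hypotheses (bQ : forall j, @rational R (b 0 j)) (bA : b \notin A).
Hypothesis Ab : relint (convex_hull [set` A]) b.
Local Notation l := (lambda A b).
Local Notation p := (circ_p A b).

Lemma barycentric_lambda : barycentric A b l.
Proof. by apply: xgetPex; exact: relint_barycentric. Qed.

Lemma lambda_rational a : a \in A -> exists r : rat, l a = ratr r.
Proof.
move=> aA; have [_ lb l1] := barycentric_lambda.
have [h [c /(_ _ l1) ->]] := affine_coordinateE Ai AQ aA.
have /choice[q bq] j : exists r : rat, b 0 j = ratr r.
  by have [r _ <-] := bQ j; exists r.
exists (\sum_j q j * h j + c); rewrite lb rmorphD rmorph_sum /=; congr (_ + _).
by apply: eq_bigr => j _; rewrite rmorphM /= bq.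
Qed.

Lemma common_denom_circ_p : common_denom A b p.
Proof.
have [l0 _ _] := barycentric_lambda.
have [q dq] : exists q, common_denom A b q.
  apply: exists_common_multiple => a aA; split; first exact/ltW/l0.
  exact: lambda_rational.
have ex : exists q, `[< common_denom A b q >] by exists q; exact/asboolP.
suff [] : common_denom A b p /\ forall q, common_denom A b q -> (p <= q)%N by [].
apply: (xgetPex 0%N (P := [set p | common_denom A b p /\
                    forall q, common_denom A b q -> (p <= q)%N])).
case: (ex_minnP ex) => r /asboolP dr rmin; exists r; split=> // q' dq'.
exact/rmin/asboolP.
Qed.

Lemma circ_numE a : a \in A -> (circ_num A b a)%:R = p%:R * l a.
Proof. by have [_ d] := common_denom_circ_p => /d /truncnK. Qed.

Lemma sum_circ_num : (\sum_(a <- A) circ_num A b a = p)%N.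
Proof.
have [_ _ l1] := barycentric_lambda.
apply/eqP; rewrite -(eqr_nat R) natr_sum big_seq (eq_bigr _ circ_numE) -big_seq.
by rewrite -mulr_sumr l1 mulr1.
Qed.

(** With p = 1 the weights would be positive integers with sum 1, so b would be a vertex of [A]. *)
Lemma circ_m_gt0 : (0 < circ_m A b)%N.
Proof.
have [p0 dp] := common_denom_circ_p; have [l0 lb l1] := barycentric_lambda.
rewrite up_log_gt0 /= ltn_neqAle p0 andbT; apply/eqP => p1.
have [a aA] : exists a, a \in A.
  apply: contrapT => A0; move/eqP: l1; rewrite big_seq big1 ?[0 == 1]eq_sym ?oner_eq0 //.
  by move=> a aA; case: A0; exists a.
have la : 1 <= l a.
  have := dp a aA; rewrite -p1 mul1r => /natrP[k lk].
  by have := l0 a aA; rewrite lk ltr0n ler1n.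
have l0' a' : a' \in (A `\ a)%fset -> 0 <= l a' by rewrite !inE => /andP[_ /l0 /ltW].
move: l1 lb; rewrite (big_fsetD1 a) //= => l1; rewrite (big_fsetD1 a) //=.
have S0 : \sum_(a' <- (A `\ a)%fset) l a' = 0.
  have Sge : 0 <= \sum_(a' <- (A `\ a)%fset) l a' by rewrite big_seq sumr_ge0.
  apply/le_anti; rewrite Sge andbT.
  by rewrite -(lerD2l (l a)) l1 addr0.
have la1 : l a = 1 by rewrite -[LHS]addr0 -S0 l1.
rewrite la1 scale1r big_seq big1 ?addr0; first by move=> ab; move: bA; rewrite -ab aA.
move=> a' a'A; move/eqP: S0; rewrite big_seq psumr_eq0 // => /allP /(_ a' a'A).
by rewrite a'A => /eqP ->; rewrite scale0r.
Qed.

Lemma pow_le_geom_mean (v : 'rV[R]_n -> R) (top : R) :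
  (forall a, a \in A -> 0 <= v a) -> 0 <= top ->
  (top ^+ p <= \prod_(a <- A) v a ^+ circ_num A b a) =
  (top <= \prod_(a <- A) v a `^ l a).
Proof.
move=> v0 top0; have [p0 _] := common_denom_circ_p.
have -> : \prod_(a <- A) v a ^+ circ_num A b a = (\prod_(a <- A) v a `^ l a) ^+ p.
  rewrite -prodrXl big_seq [RHS]big_seq; apply: eq_bigr => a aA.
  rewrite -powR_mulrn ?v0 // circ_numE // mulrC powRrM.
  by rewrite powR_mulrn // powR_ge0.
by rewrite ler_pXn2r // nnegrE prodr_ge0 // => a _; rewrite powR_ge0.
Qed.

Lemma tree_psd_le_geom_mean (v : 'rV[R]_n -> R) (top : R) s y :
  leaf_order A b s -> (forall a, a \in A -> 0 <= v a) -> 0 <= top ->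
  tree_psd (tree v A b top s y) (circ_m A b) ->
  top <= \prod_(a <- A) v a `^ l a.
Proof.
move=> so v0 top0 ty; rewrite -pow_le_geom_mean //.
have [m0 nums] := (circ_m_gt0, sum_circ_num).
exact: tree_psd_pow_le ty.
Qed.

Lemma geom_mean_tree_psd (v : 'rV[R]_n -> R) (top : R) s :
  leaf_order A b s -> (forall a, a \in A -> 0 <= v a) -> 0 <= top ->
  top <= \prod_(a <- A) v a `^ l a ->
  tree_psd (tree v A b top s (sqrt_tree (leaf v b top s))) (circ_m A b).
Proof.
move=> so v0 top0; rewrite -pow_le_geom_mean // => le.
have [m0 nums] := (circ_m_gt0, sum_circ_num).
exact: tree_psd_exists.
Qed.

End CircuitNumbers.

Lemma reduced_circuit_sub (R : realType) (n : nat) (AA C C' A : {fset 'rV[R]_n}) b :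
  (C `<=` C')%fset -> reduced_circuit AA C A b -> reduced_circuit AA C' A b.
Proof.
move=> /fsubsetP CC [AAA Ai rb bC hull]; split=> //.
by move: bC; rewrite !inE => /andP[-> /CC].
Qed.

(** * The cone and its dual *)

Section Coeff.
Context (R : realType) (n : nat) (D : {fset 'rV[R]_n}).

Lemma coeff_val (c : {ffun D -> R}) (g : D) : coeff c (val g) = c g.
Proof. by rewrite /coeff valK. Qed.

Lemma coeff_ffun (k : 'rV[R]_n -> R) g : g \in D ->
  coeff [ffun x : D => k (val x)] g = k g.
Proof. by move=> gD; rewrite -[g]/(val [` gD]%fset) coeff_val ffunE. Qed.

Lemma sum_coeff (v c : {ffun D -> R}) :
  \sum_g v g * c g = \sum_(g <- D) coeff v g * coeff c g.
Proof.
by rewrite [RHS]big_seq_fsetE; apply: eq_bigr => g _; rewrite /= !coeff_val.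
Qed.

End Coeff.

Lemma sum_fsetU_disjoint (T : choiceType) (W : nmodType) (A B : {fset T}) (F : T -> W) :
  [disjoint A & B]%fset ->
  \sum_(x <- (A `|` B)%fset) F x = \sum_(x <- A) F x + \sum_(x <- B) F x.
Proof.
move=> dAB; rewrite -big_cat; apply: perm_big; apply: uniq_perm.
- exact: fset_uniq.
- rewrite cat_uniq !fset_uniq /= andbT; apply/hasPn => x xB /=.
  by apply/negP => xA; move/fdisjointP: dAB => /(_ x xA); rewrite xB.
- by move=> x; rewrite mem_cat !inE.
Qed.

(** * Evaluation of functions and circuit test functions *)

Section Cone.
Context (R : realType) (n : nat) (AA BB : {fset 'rV[R]_n}).
Hypothesis AB : [disjoint AA & BB]%fset.
Local Notation C := (AA `|` BB)%fset.
Implicit Types (c v : {ffun C -> R}) (a b x : 'rV[R]_n).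

Definition singular a x := [exists j, (x 0 j == 0) && (a 0 j < 0)].

(** Agrees with [abs_monomial] except at singular points, where [powR] makes it 0 instead of +oo. *)
Definition real_monomial a x : R := \prod_j (`|x 0 j| `^ a 0 j).

Lemma fun_of_coeffs_real c x :
  (forall a, a \in AA -> singular a x -> coeff c a = 0) ->
  fun_of_coeffs c x = (\sum_(a <- AA) coeff c a * real_monomial a x +
    \sum_(b <- BB) coeff c b * monomial b x)%:E.
Proof.
move=> sing; rewrite /fun_of_coeffs DualAddTheoryNumDomain.dsumEFin.
rewrite [X in (X + _)%dE](_ : _ = (\sum_(a <- AA) coeff c a * real_monomial a x)%:E) //.
rewrite -DualAddTheoryNumDomain.dsumEFin big_seq [RHS]big_seq; apply: eq_bigr => a aA.
rewrite /abs_monomial -/(singular a x); case: ifP => [s|//].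
by rewrite sing // mul0e mul0r.
Qed.

Lemma fun_of_coeffs_singular c x a : a \in AA -> singular a x -> 0 < coeff c a ->
  fun_of_coeffs c x = +oo%E.
Proof.
move=> aA s ca; rewrite /fun_of_coeffs (bigD1_seq a aA (fset_uniq AA)) /=.
by rewrite {1}/abs_monomial -/(singular a x) s gt0_muley ?lte_fin.
Qed.

Lemma real_monomial_ge0 a x : 0 <= real_monomial a x.
Proof. by rewrite prodr_ge0 // => j _; rewrite powR_ge0. Qed.

Section TestFunction.
Variables (A : {fset 'rV[R]_n}) (b : 'rV[R]_n) (l w : 'rV[R]_n -> R).
Hypotheses (lb : barycentric A b l) (AAA : (A `<=` AA)%fset) (bA : b \notin A).
Hypothesis bC : b \in C.
Hypothesis w0 : forall a, a \in A -> 0 < w a.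

(** The coefficients of sum_a l_a w_a |x|^a plus k times the term of exponent b, which is |x|^b or
    x^b according to whether b lies in [AA] or in [BB]. *)
Definition test_coeff (k : R) : {ffun C -> R} :=
  [ffun g : C => (val g == b)%:R * k + (val g \in A)%:R * (l (val g) * w (val g))].

Lemma coeff_test k g : g \in C ->
  coeff (test_coeff k) g = (g == b)%:R * k + (g \in A)%:R * (l g * w g).
Proof. exact: (coeff_ffun (fun g => (g == b)%:R * k + (g \in A)%:R * (l g * w g))). Qed.

Lemma sum_test (D : {fset 'rV[R]_n}) (F : 'rV[R]_n -> R) k :
  (D `<=` C)%fset ->
  \sum_(g <- D) coeff (test_coeff k) g * F g =
  (b \in D)%:R * k * F b + \sum_(a <- A | a \in D) l a * w a * F a.
Proof.
move=> /fsubsetP DC.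
transitivity (\sum_(g <- D) ((g == b)%:R * k * F g + (g \in A)%:R * (l g * w g) * F g)).
  by rewrite big_seq [RHS]big_seq; apply: eq_bigr => g gD; rewrite coeff_test ?DC // mulrDl.
rewrite big_split /=; congr (_ + _).
  have [bD|bD] := boolP (b \in D).
    rewrite (big_fsetD1 b) //= eqxx big_seq big1 ?addr0 // => g.
    by rewrite !inE => /andP[/negbTE ->]; rewrite !mul0r.
  rewrite !mul0r big_seq big1 // => g gD.
  by case: eqP => [gb|]; [rewrite -gb gD in bD|rewrite !mul0r].
transitivity (\sum_(g <- D | g \in A) l g * w g * F g).
  rewrite [RHS]big_mkcond; apply: eq_bigr => g _.
  by case: ifP => _; rewrite ?mul1r ?mul0r.
rewrite -[RHS]big_filter -[LHS]big_filter; apply: perm_big; apply: uniq_perm.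
- by rewrite filter_uniq ?fset_uniq.
- by rewrite filter_uniq ?fset_uniq.
- by move=> g; rewrite !mem_filter andbC.
Qed.

Lemma sum_test_mul v k :
  \sum_g v g * test_coeff k g = k * coeff v b + \sum_(a <- A) l a * w a * coeff v a.
Proof.
rewrite sum_coeff; under eq_bigr do rewrite mulrC.
rewrite sum_test // bC mul1r; congr (_ + _).
rewrite big_seq_cond [RHS]big_seq; apply: eq_bigl => a.
by case: (boolP (a \in A)) => //= aA; rewrite !inE (fsubsetP AAA).
Qed.

(* Where |x|^b is infinite, so is |x|^a for some a in A, and the sum is then
   +oo in the dual addition; elsewhere this is weighted AM-GM. *)
Lemma test_nonneg k x :
  (b \in AA -> k <= 0) ->
  (b \in AA -> - k <= \prod_(a <- A) w a `^ l a) ->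
  (b \in BB -> `|k| <= \prod_(a <- A) w a `^ l a) ->
  (b \in BB -> forall x, `|monomial b x| = real_monomial b x) ->
  (0 <= fun_of_coeffs (test_coeff k) x)%E.
Proof.
have [l0 lsum l1] := lb.
move=> kb0 kbA kbB bmon.
have [[a [aA sa]]|ns] := pselect (exists a, a \in A /\ singular a x).
  rewrite (fun_of_coeffs_singular (a := a)) ?(fsubsetP AAA) //.
  rewrite coeff_test ?inE ?(fsubsetP AAA) // aA.
  case: eqP => [ab|_]; first by move: bA; rewrite -ab aA.
  by rewrite mul0r add0r mul1r mulr_gt0 ?l0 ?w0.
have ns' a j : a \in A -> x 0 j = 0 -> 0 <= a 0 j.
  move=> aA xj; rewrite leNgt; apply/negP => aj; apply: ns; exists a; split=> //.
  by apply/existsP; exists j; rewrite xj eqxx.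
rewrite fun_of_coeffs_real => [|a aAA sa]; last first.
  rewrite coeff_test ?inE ?aAA //.
  have -> : (a \in A) = false by apply/negP => aA; apply: ns; exists a.
  rewrite mul0r addr0; case: eqP => [ab|_]; last by rewrite mul0r.
  (* b_j is an average of the a_j, all non-negative where x_j = 0; hence b is not singular
     either. *)
  move: sa => /existsP[j /andP[/eqP xj]]; rewrite ab ltNge -lsum summxE => /negP[].
  by rewrite big_seq sumr_ge0 // => a' aA'; rewrite mxE mulr_ge0 ?ns' // ltW ?l0.
have geom : \prod_(a <- A) w a `^ l a * real_monomial b x <=
    \sum_(a <- A) l a * (w a * real_monomial a x).
  suff -> : \prod_(a <- A) w a `^ l a * real_monomial b x =
      \prod_(a <- A) (w a * real_monomial a x) `^ l a.
    by apply: weighted_AMGM => // a aA; rewrite mulr_ge0 ?real_monomial_ge0 // ltW ?w0.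
  transitivity (\prod_(a <- A) w a `^ l a * \prod_(a <- A) real_monomial a x `^ l a).
    congr (_ * _); rewrite /real_monomial.
    transitivity (\prod_j \prod_(a <- A) `|x 0 j| `^ (a 0 j * l a)).
      apply: eq_bigr => j _; rewrite -powR_sumr //.
        by rewrite -lsum summxE; congr (_ `^ _); apply: eq_bigr => a _; rewrite mxE mulrC.
      have [xj|xj] := eqVneq (x 0 j) 0; last by right; rewrite normr_gt0.
      by left=> a aA; rewrite mulr_ge0 ?ns' // ltW ?l0.
    rewrite exchange_big /=; apply: eq_bigr => a _.
    rewrite powR_prod => [|j]; last exact: powR_ge0.
    by apply: eq_bigr => j _; rewrite powRrM.
  rewrite -big_split /= big_seq [RHS]big_seq; apply: eq_bigr => a aA.
  by rewrite powRM ?real_monomial_ge0 // ltW ?w0.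
rewrite lee_fin sum_test; last by apply/fsubsetP => g; rewrite !inE => ->.
rewrite sum_test; last by apply/fsubsetP => g; rewrite !inE orbC => ->.
have -> : \sum_(a <- A | a \in AA) l a * w a * real_monomial a x =
    \sum_(a <- A) l a * (w a * real_monomial a x).
  rewrite big_seq_cond [RHS]big_seq; apply: eq_big => [a|a _]; last by rewrite mulrA.
  by case: (boolP (a \in A)) => //= aA; rewrite (fsubsetP AAA).
have -> : \sum_(a <- A | a \in BB) l a * w a * monomial a x = 0.
  rewrite big_seq_cond big1 // => a /andP[aA aB].
  by move/fdisjointP: AB => /(_ a (fsubsetP AAA a aA)); rewrite aB.
rewrite addr0.
have Mb := real_monomial_ge0 b x.
move: bC; rewrite !inE => /orP[] bD.
  have -> : b \in BB = false by apply/negbTE; move/fdisjointP: AB => /(_ b bD).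
  rewrite bD !mul0r addr0 mul1r addrC -[k]opprK mulNr subr_ge0.
  by apply: le_trans geom; rewrite ler_wpM2r ?kbA.
have -> : b \in AA = false.
  by apply/negbTE; move: bD; apply: contraTN => bD; move/fdisjointP: AB => /(_ b bD).
rewrite bD !mul0r add0r mul1r -lerBlDr sub0r.
apply: le_trans geom; apply: le_trans (ler_norm _) _.
by rewrite normrN normrM bmon // ler_wpM2r ?kbB.
Qed.

End TestFunction.

End Cone.

(** The geometric mean is an infimum of linear functions. For positive v the choice w = 1/v is
    optimal; if some v_a is 0, a large weight there forces u <= 0. *)
Lemma geom_mean_tangent (R : realType) (T : eqType) (s : seq T) (l v : T -> R) (u : R) :
  (forall a, a \in s -> 0 < l a) -> (forall a, a \in s -> 0 <= v a) ->
  uniq s -> \sum_(a <- s) l a = 1 ->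
  (forall w : T -> R, (forall a, a \in s -> 0 < w a) ->
     (\prod_(a <- s) w a `^ l a) * u <= \sum_(a <- s) l a * w a * v a) ->
  u <= \prod_(a <- s) v a `^ l a.
Proof.
move=> l0 v0 us l1 H.
have [[a0 [a0s va0]]|nz] := pselect (exists a, a \in s /\ v a = 0).
  apply: (@le_trans _ _ 0); last by rewrite prodr_ge0 // => a _; rewrite powR_ge0.
  rewrite leNgt; apply/negP => u0.
  pose K := \sum_(a <- s | a != a0) l a * v a.
  have K0 : 0 <= K.
    by rewrite /K big_seq_cond sumr_ge0 // => a /andP[sa _]; rewrite mulr_ge0 ?v0 // ltW ?l0.
  (* Chosen so that t^(l_a0) u = K + 1, whereas the hypothesis bounds this by K. *)
  pose t := ((K + 1) / u) `^ (l a0)^-1.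
  have t0 : 0 < t by rewrite powR_gt0 // divr_gt0 // ltr_wpDl.
  have wp a : a \in s -> 0 < (if a == a0 then t else 1) by case: ifP.
  have := H _ wp.
  rewrite !(bigD1_seq a0 a0s us) /= eqxx va0 mulr0 add0r big1 => [|a /negbTE ->]; last first.
    by rewrite powR1.
  rewrite (eq_bigr (fun a => l a * v a)) => [|a /negbTE ->]; last by rewrite mulr1.
  rewrite -/K mulr1 /t -powRrM mulVf ?gt_eqF ?l0 // powRr1; last first.
    by rewrite divr_ge0 ?ltW // ltr_wpDl.
  by rewrite divfK ?gt_eqF // gerDl ler10.
have vp a : a \in s -> 0 < v a.
  move=> sa; rewrite lt_neqAle v0 // andbT eq_sym; apply/eqP => va.
  by apply: nz; exists a.
have vVp a : a \in s -> 0 < (v a)^-1 by move=> sa; rewrite invr_gt0 vp.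
have := H _ vVp.
have -> : \sum_(a <- s) l a * (v a)^-1 * v a = 1.
  by rewrite -[RHS]l1 big_seq [RHS]big_seq; apply: eq_bigr => a sa; rewrite divfK // gt_eqF ?vp.
have P0 : 0 < \prod_(a <- s) v a `^ l a.
  by rewrite big_seq prodr_gt0 // => a sa; rewrite powR_gt0 ?vp.
have -> : \prod_(a <- s) (v a)^-1 `^ l a = (\prod_(a <- s) v a `^ l a)^-1.
  rewrite -prodfV big_seq [RHS]big_seq; apply: eq_bigr => a sa.
  by rewrite -powR_inv1 ?v0 // -powRrM mulN1r powRN.
by rewrite ler_pdivrMl // mulr1.
Qed.

(** * From the dual cone to the circuit inequalities *)

Section DualToCircuits.
Context (R : realType) (n : nat) (AA BB : {fset 'rV[R]_n}).
Hypothesis AB : [disjoint AA & BB]%fset.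
Hypothesis BN : forall b, b \in BB -> forall j, exists k : nat, b 0 j = k%:R.
Local Notation C := (AA `|` BB)%fset.
Variable v : {ffun C -> R}.
Hypothesis dv : dual_S_cone AA BB v.

Lemma norm_monomial b x : b \in BB -> `|monomial b x| = real_monomial b x.
Proof.
move=> bB; rewrite normr_prod; apply: eq_bigr => j _.
by have [k ->] := BN bB j; rewrite powR_mulrn // natrK normrX.
Qed.

Lemma dual_AG c : AG c -> (forall x, (0 <= fun_of_coeffs c x)%E) ->
  0 <= \sum_g v g * c g.
Proof.
move=> cAG c0; apply: dv; exists 1%N, (fun=> c), (fun=> 1); split=> //.
by rewrite big_ord1 scale1r.
Qed.

Lemma dual_ge0 a : a \in AA -> 0 <= coeff v a.
Proof.
move=> aA; pose c : {ffun C -> R} := [ffun g : C => (val g == a)%:R].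
have cE g : g \in C -> coeff c g = (g == a)%:R.
  exact: (coeff_ffun (fun g => (g == a)%:R)).
have sE (D : {fset 'rV[R]_n}) F : (D `<=` C)%fset ->
    \sum_(g <- D) coeff c g * F g = (a \in D)%:R * F a :> R.
  move=> /fsubsetP DC.
  transitivity (\sum_(g <- D) (g == a)%:R * F g).
    by rewrite big_seq [RHS]big_seq; apply: eq_bigr => g gD; rewrite cE ?DC.
  have [aD|aD] := boolP (a \in D).
    rewrite (big_fsetD1 a) //= eqxx big_seq big1 ?addr0 // => g.
    by rewrite !inE => /andP[/negbTE ->]; rewrite mul0r.
  rewrite mul0r big_seq big1 // => g gD.
  by case: eqP => [ga|]; [rewrite -ga gD in aD|rewrite mul0r].
have aB : a \in BB = false by apply/negbTE; move/fdisjointP: AB => /(_ a aA).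
have <- : \sum_g v g * c g = coeff v a.
  rewrite sum_coeff; under eq_bigr do rewrite mulrC.
  by rewrite sE // inE aA mul1r.
apply: dual_AG.
  left; split=> [g g' gA g'A|b bB].
    by rewrite cE ?inE ?gA // ltNge ler0n.
  by rewrite cE ?inE ?bB ?orbT //; case: eqP => // ba; rewrite -ba bB in aB.
move=> x; have [sa|sa] := boolP (singular a x).
  by rewrite (fun_of_coeffs_singular aA sa) // cE ?inE ?aA // eqxx.
rewrite fun_of_coeffs_real => [|g gA sg]; last first.
  by rewrite cE ?inE ?gA //; case: eqP => // ga; rewrite -ga sg in sa.
rewrite lee_fin !sE; try by apply/fsubsetP => g; rewrite !inE => ->; rewrite ?orbT.
by rewrite aA aB mul0r addr0 mul1r real_monomial_ge0.
Qed.

(** Pairing v with the test function of coefficient k W at b, where W is the geometric mean of w,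
    gives one linear bound for each w; the best of them is the geometric mean of v. The sign k is
    free for odd circuits and -1 for even ones. *)
Lemma dual_circuit_le A b l (k : R) : (A `<=` AA)%fset -> b \notin A ->
  barycentric A b l -> b \in C -> `|k| = 1 -> (b \in AA -> k = -1) ->
  - k * coeff v b <= \prod_(a <- A) coeff v a `^ l a.
Proof.
move=> AAA bA lb bC k1 kA; have [l0 _ l1] := lb.
apply: geom_mean_tangent => // [a aA|w w0].
  exact/dual_ge0/(fsubsetP AAA).
set W := \prod_(a <- A) w a `^ l a.
have W0 : 0 <= W by rewrite prodr_ge0 // => a _; rewrite powR_ge0.
suff : 0 <= \sum_g v g * test_coeff AA BB A b l w (k * W) g.
  by rewrite sum_test_mul // => H; lra.
have cE := @coeff_test R n AA BB A b l w.
have dis g : g \in AA -> g \in BB -> False.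
  by move=> gA gB; move/fdisjointP: AB => /(_ g gA); rewrite gB.
apply: dual_AG => [|x]; last first.
  apply: test_nonneg => // bD.
  - by rewrite kA // mulN1r oppr_le0.
  - by rewrite kA // mulN1r opprK.
  - by rewrite normrM k1 mul1r ger0_norm.
  - by move=> y; exact: norm_monomial.
have posA g : g \in AA -> g != b -> 0 <= coeff (test_coeff AA BB A b l w (k * W)) g.
  move=> gA gb; rewrite cE ?inE ?gA // (negbTE gb) mul0r add0r.
  case: (boolP (g \in A)) => gA'; last by rewrite mul0r.
  by rewrite mul1r mulr_ge0 // ltW ?l0 ?w0.
have zeroB g : g \in BB -> g != b -> coeff (test_coeff AA BB A b l w (k * W)) g = 0.
  move=> gB gb; rewrite cE ?inE ?gB ?orbT // (negbTE gb) mul0r add0r.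
  case: (boolP (g \in A)) => gA'; last by rewrite mul0r.
  by case: (dis g) => //; exact: (fsubsetP AAA).
move: bC; rewrite inE => /orP[bD|bD].
  left; split=> [a a' aA a'A na na'|b' b'B].
    have [->|/(posA a aA)] := eqVneq a b; last by rewrite leNgt na.
    have [->//|/(posA a' a'A)] := eqVneq a' b; by rewrite leNgt na'.
  by apply: zeroB => //; apply/eqP => b'b; apply: (dis b); rewrite // -b'b.
right; split=> [a aA|b1 b2 b1B b2B n1 n2].
  by apply: posA => //; apply/eqP => ab; apply: (dis a); rewrite // ab.
have [->|/(zeroB b1 b1B) e] := eqVneq b1 b; last by rewrite e eqxx in n1.
have [->//|/(zeroB b2 b2B) e] := eqVneq b2 b; by rewrite e eqxx in n2.
Qed.

End DualToCircuits.

(** * From the circuit inequalities to the dual cone *)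

Section CircuitsToDual.
Context (R : realType) (n : nat) (AA BB : {fset 'rV[R]_n}).
Hypothesis AB : [disjoint AA & BB]%fset.
Hypothesis AQ : rational_points AA.
Hypothesis BN : forall b, b \in BB -> forall j, exists k : nat, b 0 j = k%:R.
Hypothesis BO : forall b, b \in BB ->
  ~ (forall j, exists k : nat, b 0 j = (2 * k)%N%:R).
Local Notation C := (AA `|` BB)%fset.
Variable v : {ffun C -> R}.
Hypothesis v0 : forall a, a \in AA -> 0 <= coeff v a.
Hypothesis circuit_le : forall A b l, reduced_circuit AA C A b -> barycentric A b l ->
  `|coeff v b| <= \prod_(a <- A) coeff v a `^ l a.

(** The value of |x|^a at a point with |x_j| = exp(y_j). *)
Definition exp_form (y : 'I_n -> R) (a : 'rV[R]_n) : R := expR (\sum_j a 0 j * y j).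

Lemma supporting_exp_form b (e : R) : b \in C -> 0 < e ->
  exists y, forall a, a \in (AA `\ b)%fset ->
    exp_form y a * (`|coeff v b| + e) <= exp_form y b * (coeff v a + e).
Proof.
move=> bC e0; pose f x := ln (`|coeff v x| + e).
have fE x : expR (f x) = `|coeff v x| + e by rewrite lnK // posrE ltr_wpDl.
have hull A : (A `<=` AA)%fset -> hull_le C f A.
  move=> AAA; apply: (reduced_circuits_hull_le (AA := AA)) => //.
    by apply/fsubsetP => x; rewrite inE => ->.
  move=> {}A {AAA} b' l rc lb; have [AAA _ _ _ _] := rc; have [l0 _ l1] := lb.
  have vA a : a \in A -> 0 <= coeff v a by move=> aA; exact/v0/(fsubsetP AAA).
  rewrite -ler_expR fE expR_sum.
  have -> : \prod_(a <- A) expR (l a * f a) = \prod_(a <- A) (coeff v a + e) `^ l a.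
    rewrite big_seq [RHS]big_seq; apply: eq_bigr => a aA.
    by rewrite /powR gt_eqF ?ltr_wpDl ?vA // /f ger0_norm ?vA.
  by apply: le_trans (geom_mean_addr l0 l1 vA e0); rewrite lerD2r circuit_le.
have [[y Hy]|[w [w0 wu wg]]] :=
    farkas (fun a => a - b) (fun a => f a - f b) (fset_uniq (AA `\ b)%fset).
  exists y => a aD; have := Hy a aD.
  have -> : \sum_j (a - b) 0 j * y j = \sum_j a 0 j * y j - \sum_j b 0 j * y j.
    by rewrite -sumrB; apply: eq_bigr => j _; rewrite !mxE mulrBl.
  have -> : coeff v a + e = expR (f a).
    by rewrite fE ger0_norm // v0 //; move: aD; rewrite !inE => /andP[].
  rewrite -fE -!expRD ler_expR; lra.
(* A certificate with negative value cannot vanish, so its multipliers can be divided by their sum.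
   They express b as a convex combination of other points of [AA] at which f violates [hull]. *)
set T := \sum_(a <- (AA `\ b)%fset) w a.
have T0 : 0 < T.
  rewrite lt_neqAle sumr_ge0 // andbT eq_sym psumr_eq0 //; apply/negP => /allP wa0.
  move: wg; rewrite big_seq big1 ?ltxx // => a aD.
  by have /eqP -> := wa0 a aD; rewrite mul0r.
have cw : convex_weights (AA `\ b)%fset b (fun a => T^-1 * w a).
  split=> [a _||]; first by rewrite mulr_ge0 // invr_ge0 ltW.
    by rewrite -mulr_sumr mulVf // gt_eqF.
  under eq_bigr do rewrite -scalerA; rewrite -scaler_sumr.
  move: wu; under eq_bigr do rewrite scalerBr; rewrite sumrB => /subr0_eq ->.
  by rewrite -scaler_suml scalerA mulVf ?scale1r // gt_eqF.
have := hull _ (fsubD1set AA b) b _ bC cw.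
under eq_bigr do rewrite -mulrA; rewrite -mulr_sumr mulrC ler_pdivlMr //.
move: wg; under eq_bigr do rewrite mulrBr; rewrite sumrB -mulr_suml -/T.
rewrite mulrC; lra.
Qed.

Lemma AG_dual_le b (c : 'rV[R]_n -> R) (K : R) : b \in C -> 0 <= K ->
  (forall a, a \in (AA `\ b)%fset -> 0 <= c a) ->
  (forall y, K * exp_form y b <= \sum_(a <- (AA `\ b)%fset) c a * exp_form y a) ->
  K * `|coeff v b| <= \sum_(a <- (AA `\ b)%fset) c a * coeff v a.
Proof.
move=> bC K0 c0 H; set D := (AA `\ b)%fset in c0 H *.
set S := \sum_(a <- D) c a.
have S0 : 0 <= S by rewrite /S big_seq sumr_ge0.
apply/ler_addgt0Pr => e e0.
(* Shifting every v_a by d changes the right-hand side by S d, which is at most e; the added 1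
   covers S = 0. *)
pose d := e / (S + 1).
have d0 : 0 < d by rewrite divr_gt0 // ltr_wpDl.
have [y Hy] := supporting_exp_form bC d0.
have yb : 0 < exp_form y b by exact: expR_gt0.
have : K * (`|coeff v b| + d) <= \sum_(a <- D) c a * (coeff v a + d).
  rewrite -(ler_pM2l yb) mulr_sumr.
  apply: (@le_trans _ _ (\sum_(a <- D) c a * exp_form y a * (`|coeff v b| + d))).
    by rewrite -mulr_suml mulrCA mulrA ler_wpM2r ?addr_ge0 ?(ltW d0) //.
  rewrite big_seq [leRHS]big_seq; apply: ler_sum => a aD.
  by rewrite -mulrA [leRHS]mulrCA ler_wpM2l ?c0 ?Hy.
under [leRHS]eq_bigr do rewrite mulrDr.
rewrite big_split /= -mulr_suml -/S.
have Kd : 0 <= K * d by rewrite mulr_ge0 // ltW.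
have Sd : S * d <= e.
  by rewrite /d mulrA ler_pdivrMr ?ltr_wpDl // mulrC ler_pM2l // lerDl.
rewrite mulrDr; lra.
Qed.

Lemma dual_of_circuits : dual_S_cone AA BB v.
Proof.
move=> _ [k [p [t [pAG t0 ->]]]].
rewrite (eq_bigr (fun g => \sum_i t i * (v g * p i g))); last first.
  move=> g _; rewrite sum_ffunE mulr_sumr; apply: eq_bigr => i _.
  by rewrite ffunE mulrCA.
rewrite exchange_big /= sumr_ge0 // => i _; rewrite -mulr_sumr mulr_ge0 //.
have [cAG c0] := pAG i; move: (p i) cAG c0 => c cAG c0.
rewrite sum_coeff sum_fsetU_disjoint //.
(* Points without zero coordinates avoid the value +oo, and s prescribes their signs. *)
have eval (s : 'I_n -> bool) y : 0 <= \sum_(a <- AA) coeff c a * exp_form y a +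
    \sum_(b <- BB) coeff c b * monomial b (\row_j ((-1) ^+ s j * expR (y j))).
  have := c0 (\row_j ((-1) ^+ s j * expR (y j))).
  rewrite fun_of_coeffs_real => [|a _ /existsP[j]]; last first.
    by rewrite mxE mulf_eq0 signr_eq0 gt_eqF ?expR_gt0.
  rewrite lee_fin; congr (_ <= _ + _); apply: eq_bigr => a _; congr (_ * _).
  rewrite /exp_form expR_sum; apply: eq_bigr => j _.
  by rewrite mxE normrM normrX normrN1 expr1n mul1r ger0_norm ?expR_ge0 //
    /powR gt_eqF ?expR_gt0 // expRK.
have nonneg : (forall a, a \in AA -> 0 <= coeff c a) ->
    0 <= \sum_(a <- AA) coeff v a * coeff c a.
  by move=> ca; rewrite big_seq sumr_ge0 // => a aA; rewrite mulr_ge0 ?v0 ?ca.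
case: cAG => [[neg odd0]|[pos odd1]].
  rewrite [X in _ + X]big_seq [X in _ + X]big1 ?addr0 => [|b bB]; last first.
    by rewrite odd0 // mulr0.
  have [[a0 [aA0 ca0]]|none] := pselect (exists a, a \in AA /\ coeff c a < 0); last first.
    by apply: nonneg => a aA; rewrite leNgt; apply/negP => ca; apply: none; exists a.
  have := @AG_dual_le a0 (coeff c) (- coeff c a0).
  rewrite inE aA0 => /(_ isT); rewrite oppr_ge0 ltW // => /(_ isT) H.
  rewrite (big_fsetD1 a0) //=.
  have {}H : - coeff c a0 * `|coeff v a0| <=
      \sum_(a <- (AA `\ a0)%fset) coeff c a * coeff v a.
    apply: H => [a|y].
      rewrite !inE => /andP[aa0 aA]; rewrite leNgt; apply/negP => ca.
      by move/eqP: aa0; apply; exact: neg.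
    have := eval (fun=> false) y.
    rewrite [X in _ + X]big_seq [X in _ + X]big1 ?addr0 => [|b bB]; last first.
      by rewrite odd0 // mul0r.
    by rewrite (big_fsetD1 a0) //=; lra.
  move: H; rewrite ger0_norm ?v0 //.
  under eq_bigr do rewrite mulrC.
  lra.
have [[b [bB cb]]|none] := pselect (exists b, b \in BB /\ coeff c b != 0); last first.
  rewrite [X in _ + X]big_seq [X in _ + X]big1 ?addr0 => [|b bB]; first exact: nonneg.
  have [-> |cb] := eqVneq (coeff c b) 0; first by rewrite mulr0.
  by case: none; exists b.
have one (F : 'rV[R]_n -> R) : \sum_(b' <- BB) coeff c b' * F b' = coeff c b * F b.
  rewrite (big_fsetD1 b) //= big_seq big1 ?addr0 // => b'.
  rewrite !inE => /andP[b'b b'B]; have [->|cb'] := eqVneq (coeff c b') 0.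
    by rewrite mul0r.
  by case/eqP: b'b; exact: odd1.
have AAb : (AA `\ b)%fset = AA.
  apply/fsetP => a; rewrite !inE; case: eqP => //= ->.
  by apply/esym/negbTE/negP => bA; move/fdisjointP: AB => /(_ b bA); rewrite bB.
have := @AG_dual_le b (coeff c) `|coeff c b|.
rewrite inE bB orbT AAb => /(_ isT (normr_ge0 _) pos) H.
have {}H : `|coeff c b| * `|coeff v b| <= \sum_(a <- AA) coeff c a * coeff v a.
  apply: H => y.
  have [j0 odd_j0] : exists j, forall k : nat, b 0 j = k%:R -> odd k.
    apply: contrapT => H; apply: (BO bB) => j; apply: contrapT => Hj; apply: H; exists j => k' bk.
    apply/negPn/negP => ek; apply: Hj; exists k'./2.
    by rewrite bk mul2n even_halfK.
  (* Only the odd coordinate is made negative, and only when the coefficient is positive, so that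
     the term of x^b becomes minus its absolute value. *)
  pose s j := (j == j0) && (0 < coeff c b).
  have := eval s y; rewrite one.
  suff -> : coeff c b * monomial b (\row_j ((-1) ^+ s j * expR (y j))) =
      - (`|coeff c b| * exp_form y b) by rewrite subr_ge0.
  have -> : monomial b (\row_j ((-1) ^+ s j * expR (y j))) =
      (-1) ^+ (0 < coeff c b)%R * exp_form y b.
    rewrite /exp_form expR_sum (bigD1 j0) //= /monomial (bigD1 j0) //= mulrA.
    have mono j : (\row_j ((-1) ^+ s j * expR (y j)) : 'rV[R]_n) 0 j ^+ Num.truncn (b 0 j) =
        ((-1) ^+ s j) ^+ Num.truncn (b 0 j) * expR (b 0 j * y j).
      have [k' bk] := BN bB j.
      by rewrite mxE exprMn bk natrK -expRM_natl.
    rewrite mono; congr (_ * _ * _).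
      have [k' bk] := BN bB j0; rewrite bk natrK /s eqxx /= -exprM mulnC exprM.
      by rewrite -signr_odd (odd_j0 _ bk).
    by apply: eq_bigr => j /negbTE jj0; rewrite mono /s jj0 expr0 expr1n mul1r.
  have [cp|cn] := ltP 0 (coeff c b).
    by rewrite (gtr0_norm cp) expr1; ring.
  by rewrite (ler0_norm cn) expr0; ring.
under [X in _ + X]eq_bigr do rewrite mulrC.
rewrite one; under eq_bigr do rewrite mulrC.
have : - (`|coeff c b| * `|coeff v b|) <= coeff c b * coeff v b.
  by rewrite -normrM lerNl -normrN ler_norm.
lra.
Qed.

End CircuitsToDual.

(** An exponent of [AA] that lies in no reduced circuit occurs in no block, so non-negativity of v
    on [AA] stands as a separate conjunct. Membership in the dual cone implies it, as each |x|^a is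
    a non-negative AG function. *)
Theorem corollary4p4 (R : realType) (n : nat) (AA BB : {fset 'rV[R]_n})
    (hA0 : AA != fset0)
    (hAQ : forall a, a \in AA -> forall j, @rational R (a 0 j))
    (hBN : forall b, b \in BB -> forall j, exists k : nat, b 0 j = k%:R)
    (hBodd : forall b, b \in BB ->
       ~ (forall j, exists k : nat, b 0 j = (2 * k)%N%:R))
    (hAB : [disjoint AA & BB]%fset)
    (* an order of appearance in the level 1 blocks, for every circuit *)
    (s : {fset 'rV[R]_n} -> 'rV[R]_n -> seq 'rV[R]_n)
    (hs : forall A b, reduced_circuit AA (AA `|` BB)%fset A b ->
       leaf_order A b (s A b))
    (v : {ffun (AA `|` BB)%fset -> R}) :
  dual_S_cone AA BB v <->
  (forall a, a \in AA -> 0 <= coeff v a) /\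
  exists (y : {fset 'rV[R]_n} -> 'rV[R]_n -> nat -> nat -> R)
         (yb : {fset 'rV[R]_n} -> 'rV[R]_n -> R),
    (forall A b, reduced_circuit AA BB A b ->
       odd_circuit_cond (coeff v) A b (s A b) (y A b) (yb A b)) /\
    (forall A b, reduced_circuit AA AA A b ->
       psd (dual_circuit_mx (coeff v) A b (s A b) (y A b))).
Proof.
have hQ b : b \in (AA `|` BB)%fset -> forall j, @rational R (b 0 j).
  rewrite inE => /orP[/hAQ //|/hBN bN] j.
  by have [k ->] := bN j; exists k%:R; rewrite ?ratr_nat.
have sBB : (BB `<=` AA `|` BB)%fset by apply/fsubsetP => b bB; rewrite inE bB orbT.
have sAA : (AA `<=` AA `|` BB)%fset by apply/fsubsetP => b bA; rewrite inE bA.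
have circuitP A b : reduced_circuit AA (AA `|` BB)%fset A b ->
    [/\ affinely_independent A, rational_points A, forall j, @rational R (b 0 j),
        b \notin A & relint (convex_hull [set` A]) b].
  move=> [/fsubsetP AAA Ai rb]; rewrite inE => /andP[bA bC] _; split=> //.
    by move=> a aA; exact/hAQ/AAA.
  exact: hQ.
have psdP A b y : reduced_circuit AA (AA `|` BB)%fset A b ->
    psd (dual_circuit_mx (coeff v) A b (s A b) y) <->
    0 <= coeff v b /\
      tree_psd (tree (coeff v) A b (coeff v b) (s A b) y) (circ_m A b).
  move=> rc; have [Ai AQ bQ bA rb] := circuitP A b rc.
  by apply: psd_dual_circuit_mx; exact: circ_m_gt0.
have oddP A b y yb : reduced_circuit AA (AA `|` BB)%fset A b ->
    odd_circuit_cond (coeff v) A b (s A b) y yb <->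
    tree_psd (tree (coeff v) A b yb (s A b) y) (circ_m A b) /\ `|coeff v b| <= yb.
  move=> rc; have [Ai AQ bQ bA rb] := circuitP A b rc.
  have m0 : (0 < circ_m A b)%N by exact: circ_m_gt0.
  by rewrite tree_psdP //; split=> [[]|[[]]].
split=> [dv|[v0 [y [yb [odd_ok even_ok]]]]].
  have v0 := dual_ge0 hAB dv; split=> //.
  (* The absolute value lets one formula serve both kinds of circuits: on even ones it is v_b
     itself. *)
  exists (fun A b => sqrt_tree (leaf (coeff v) b `|coeff v b| (s A b))),
         (fun A b => `|coeff v b|).
  have vA A b : reduced_circuit AA (AA `|` BB)%fset A b ->
      forall a, a \in A -> 0 <= coeff v a.
    by move=> [/fsubsetP AAA _ _ _ _] a /AAA; exact: v0.
  split=> A b rc.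
    have rc' := reduced_circuit_sub sBB rc.
    have [Ai AQ bQ bA rb] := circuitP A b rc'.
    have [AAA _ _ bB _] := rc; have {}bB : b \in BB by move: bB; rewrite inE => /andP[].
    apply/oddP => //; split=> //.
    apply: geom_mean_tree_psd => //; [exact: hs|exact: vA rc'|].
    have bnA : b \in AA -> False by move=> bA'; move/fdisjointP: hAB => /(_ b bA'); rewrite bB.
    (* The signs k = 1 and k = -1 give the two halves of the bound on |v_b|. *)
    have le k : `|k| = 1 -> - k * coeff v b <= \prod_(a <- A) coeff v a `^ lambda A b a.
      move=> k1; apply: (dual_circuit_le hAB hBN dv) => //.
      - exact: barycentric_lambda.
      - exact: (fsubsetP sBB).
    rewrite ler_norml lerNl; apply/andP; split.
      by rewrite -mulN1r le // normr1.
    by rewrite -[coeff v b]mul1r -{1}[1]opprK le // normrN1.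
  have rc' := reduced_circuit_sub sAA rc.
  have [Ai AQ bQ bA rb] := circuitP A b rc'.
  have [AAA _ _ bB _] := rc; have {}bB : b \in AA by move: bB; rewrite inE => /andP[].
  apply/psdP => //; rewrite (ger0_norm (v0 b bB)); split; first exact: v0.
  apply: geom_mean_tree_psd => //; [exact: hs|exact: vA rc'|exact: v0|].
  rewrite -[coeff v b]mul1r -{1}[1]opprK.
  apply: (dual_circuit_le hAB hBN dv) => //; rewrite ?normrN1 //.
    exact: barycentric_lambda.
  exact: (fsubsetP sAA).
apply: dual_of_circuits => // A b l rc lb.
have [Ai AQ bQ bA rb] := circuitP A b rc.
have [/fsubsetP AAA _ _ bC hull] := rc.
have vA a : a \in A -> 0 <= coeff v a by move=> /AAA; exact: v0.
have -> : \prod_(a <- A) coeff v a `^ l a = \prod_(a <- A) coeff v a `^ lambda A b a.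
  rewrite big_seq [RHS]big_seq; apply: eq_bigr => a aA; congr (_ `^ _).
  have [[_ lx l1] [_ Lx L1]] := (lb, barycentric_lambda Ai rb).
  by apply: (affinely_independent_uniq Ai); rewrite ?l1 ?lx.
have so := hs A b rc.
move: bC; rewrite !inE => /andP[_ /orP[bD|bD]].
  have rcA : reduced_circuit AA AA A b by have [? ? ? _ ?] := rc; split; rewrite // inE bA.
  have /(psdP A b _ rc)[vb ty] := even_ok A b rcA.
  by rewrite ger0_norm //; exact: tree_psd_le_geom_mean ty.
have rcB : reduced_circuit AA BB A b by have [? ? ? _ ?] := rc; split; rewrite // inE bA.
have /(oddP A b _ _ rc)[ty vyb] := odd_ok A b rcB.
apply: (le_trans vyb); apply: tree_psd_le_geom_mean ty => //.
by rewrite (le_trans _ vyb).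
Qed.
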